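(* Let $N$ be a counting process such that $N(\infty) \le B$ almost surely for some $B > 0$, and let $F(s) = \operatorname{E}(N(s))$, $s\in[0,\infty]$, be its mean function. For each $n \in \mathbb{N}$ let $F_n = n^{-1}\sum_{i=1}^n N_i$ be the average of independent replications $N_1, \dots, N_n$ of $N$ (i.e. independent processes with the same distribution as $N$). Then for every $p \in [1,2)$ there exists a constant $\lambda$, depending on $p$ and $B$, such that $$\limsup_{n\to\infty} n^{\frac{p-1}{p}} \|F_n - F\|_{[p]} \leq \lambda$$ almost surely. In particular, $\|F_n - F\|_{[p]} = O(n^{(1-p)/p})$ almost surely.
   Context: A counting process $N$ is a stochastic process indexed by $[0,\infty]$ (each $N(s)$ is a random variable) whose paths take only non-negative integer values, are increasing ($N(t) \ge N(s)$ for $t \ge s$), are right-continuous with left limits, and satisfy $N(0)=0$ and $N(\infty) = \lim_{t\to\infty} N(t)$. For $p \ge 1$ and a real function $f$ on $J = [0,\infty)$, the $p$-variation is $v_p(f) = \sup \sum_{j=1}^m |f(t_j) - f(t_{j-1})|^p$, the supremum being over all $m \in \mathbb{N}$ and all $t_0 < t_1 < \dots < t_m$ in $J$. Put $\|f\|_{(p)} = v_p(f)^{1/p}$, $\|f\|_\infty = \sup_{t \in J}|f(t)|$, and $\|f\|_{[p]} = \|f\|_{(p)} + \|f\|_\infty$ (the $p$-variation norm). *)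

(* Defs.v *)
From HB Require Import structures.
From mathcomp Require Import all_boot all_order all_algebra.
From mathcomp Require Import all_classical all_reals all_analysis.
Set Implicit Arguments.
Unset Strict Implicit.
Unset Printing Implicit Defensive.
Import Order.TTheory GRing.Theory Num.Theory.
Import numFieldNormedType.Exports.
Local Open Scope classical_set_scope.
Local Open Scope ring_scope.

(* A process indexed by [0, +oo] is a function N : \bar R -> T -> R, where
   N s w is the value at time s of the path of w.  Every definition below
   uses its values at times 0 <= s only. *)

Record counting_process d (T : measurableType d) (R : realType)
    (N : \bar R -> T -> R) : Prop := CountingProcess {
  counting_measurable : forall s, (0 <= s)%E -> measurable_fun setT (N s);
  counting_nat : forall s w, (0 <= s)%E -> N s w \is a Num.nat;
  counting_incr : forall s t w, (0 <= s)%E -> (s <= t)%E -> N s w <= N t w;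
  counting_right_cont : forall (t : R) w, 0 <= t ->
    N s%:E w @[s --> t^'+] --> N t%:E w;
  counting_left_lim : forall (t : R) w, 0 < t ->
    cvg (N s%:E w @[s --> t^'-]);
  counting0 : forall w, N 0%E w = 0;
  counting_infty : forall w, N t%:E w @[t --> +oo] --> N +oo%E w
}.

Definition path_of (I T R : Type) (N : I -> T -> R) (w : T) : I -> R :=
  N ^~ w.

(* The sigma-algebra on paths generated by the evaluations at times in
   [0, +oo]: a process is considered as a random path with values in it. *)
Definition path_events (R : realType) : set (set (\bar R -> R)) :=
  <<s [set C | exists s (A : set R), [/\ (0 <= s)%E, measurable A &
                 C = [set f : \bar R -> R | A (f s)]]] >>.
Arguments path_events : clear implicits.

(* The two processes may be defined on different probability spaces. *)
Definition same_distribution d (T : measurableType d)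
    d' (T' : measurableType d') (R : realType)
    (P : probability T R) (N : \bar R -> T -> R)
    (P' : probability T' R) (N' : \bar R -> T' -> R) : Prop :=
  forall A, path_events R A ->
    P' (path_of N' @^-1` A) = P (path_of N @^-1` A).

Definition independent_processes d (T : measurableType d) (R : realType)
    (P : probability T R) (N : nat -> \bar R -> T -> R) : Prop :=
  forall (I : seq nat) (A : nat -> set (\bar R -> R)),
    uniq I -> (forall i, path_events R (A i)) ->
    P (\bigcap_(i in [set` I]) path_of (N i) @^-1` A i)
      = (\prod_(i <- I) P (path_of (N i) @^-1` A i))%E.

(* Real-valued: 'E_P[N s] is finite whenever N +oo is almost surely bounded. *)
Definition mean_function d (T : measurableType d) (R : realType)
    (P : probability T R) (N : \bar R -> T -> R) (s : \bar R) : R :=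
  fine ('E_P[N s])%E.

(* The family starts at index 0, so the average is over N 0, ..., N n.-1. *)
Definition empirical_mean (T : Type) (R : realType)
    (N : nat -> \bar R -> T -> R) (n : nat) (s : \bar R) (w : T) : R :=
  n%:R^-1 * \sum_(i < n) N i s w.

(* The p-variation and the norms of f on J = [0, +oo[ take values in \bar R;
   values of f outside J are ignored. *)
Definition pvariation (R : realType) (p : R) (f : R -> R) : \bar R :=
  ereal_sup [set v | exists (m : nat) (t : nat -> R),
    [/\ 0 <= t 0%N, (forall j, (j < m)%N -> t j < t j.+1) &
        v = (\sum_(1 <= j < m.+1) `|f (t j) - f (t j.-1)| `^ p)%:E]].

Definition pvar_seminorm (R : realType) (p : R) (f : R -> R) : \bar R :=
  (pvariation p f `^ p^-1)%E.

Definition sup_norm (R : realType) (f : R -> R) : \bar R :=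
  ereal_sup [set `|f t|%:E | t in [set t : R | 0 <= t]].

Definition pvar_norm (R : realType) (p : R) (f : R -> R) : \bar R :=
  (pvar_seminorm p f + sup_norm f)%E.

(* Main.v *)
Require Import Defs.
From HB Require Import structures.
From mathcomp Require Import all_boot all_order all_algebra.
From mathcomp Require Import all_classical all_reals all_analysis.
From mathcomp Require Import measurable_realfun.
From mathcomp Require Import ring lra zify.
(** Let S_n = N_1 + ... + N_n - n F.  The claim says that almost surely
    the p-variation seminorm of S_n is eventually at most a constant times
    n^(1/p); the supremum norm follows because S_n vanishes at 0.  The proof
    compares S_n with its values at a nested family of finite sets of times
    (chaining) and controls each level through sums of squares.

    For 2^m <= n < 2^(m+1), the time axis is cut at each level h <= m into at
    most 2^h cells, on each of which F varies by at most (B + 1) / 2^h, and S_n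
    is written as a telescoping sum of differences of step functions, one
    for each level, plus a rest inside the cells of level m
    ([chaining_pvar]).  Let x_c be the increments of S_n at level h.  The
    sum of the x_c^2 has mean of order at most n, because all increments of one
    process together are bounded.  If it were not much larger than its mean,
    then Hoelder's inequality over 2^h terms would give a sum of |x_c|^p of
    order (2^h)^(1 - p/2) n^(p/2); since p < 2 this increases geometrically
    with h, and the level with 2^h of order n, where the bound is of order n,
    dominates.  There is even room for a geometric factor in the allowed size
    of the sum of squares at the coarser levels ([level_power_sum]).

    It remains to keep all these sums of squares below their allowance.
    Each one is a bounded diagonal plus twice a degenerate U-statistic,
    with kernel the inner product of the centered increment vectors of
    two copies of the process.  This kernel has second moment of order at
    most 2^-h ([centered_gram_sqr]), its values at different pairs of copies are
    orthogonal, and the Rademacher-Menshov argument extends Chebyshev's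
    inequality to all n <= 2^(m+1) at once at the price of a factor of order
    m^2 ([ustat_max_tail]).  The bad events of all levels together have a
    probability that decreases exponentially in m up to a power of m
    ([block_event]), and Borel-Cantelli concludes ([eventually_pvar_bound]).

    At a given level only finitely many times matter and the counts take
    finitely many values, so the n copies of the process are replaced by
    a finite product space with product weights ([state_product]); all
    moments are finite sums. *)

Set Implicit Arguments.
Unset Strict Implicit.
Unset Printing Implicit Defensive.
Import Order.TTheory GRing.Theory Num.Theory.
Import numFieldNormedType.Exports.
Local Open Scope classical_set_scope.
Local Open Scope ring_scope.

(** * Powers and bounds on the p-variation *)

Section PowersAndVariation.
Variable R : realType.
Implicit Types (p x y tau : R).

Lemma eq_ler x y : x = y -> x <= y.
Proof. by move=> ->. Qed.

Lemma powR_dist_le4 p x y : 1 <= p < 2 ->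
  `|x - y| `^ p <= 4 * (`|x| `^ p + `|y| `^ p).
Proof.
move=> /andP[p1 p2]; have p0 : 0 <= p by lra.
pose M := Num.max `|x| `|y|.
have M0 : 0 <= M by rewrite le_max normr_ge0.
have xyM : `|x - y| <= 2 * M.
  rewrite (le_trans (ler_normB _ _))// mulr_natl mulr2n lerD// le_max lexx//.
  by rewrite orbT.
apply: (@le_trans _ _ ((2 * M) `^ p)).
  by apply: ge0_ler_powR => //; rewrite nnegrE ?normr_ge0 ?mulr_ge0.
rewrite powRM//; apply: ler_pM; rewrite ?powR_ge0//.
  apply: (@le_trans _ _ (2 `^ 2%:R)); first by apply: ler_powR; lra.
  by rewrite powR_mulrn//; lra.
rewrite /M maxEle; case: ifP => _; rewrite ?lerDl ?lerDr powR_ge0//.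
Qed.

(** Below tau the first term suffices; above it x^p = x^(p-2) x^2 with a
    negative exponent p - 2.  Used with a well-chosen tau at each level, this
    passes from sums of squares, which have computable moments, to sums of
    p-th powers. *)
Lemma powR_threshold p x tau : p < 2 -> 0 <= p -> 0 <= x -> 0 < tau ->
  x `^ p <= tau `^ p + tau `^ p / tau ^+ 2 * x ^+ 2.
Proof.
move=> p2 p0 x0 t0; have tp := powR_gt0 p t0.
have [xt|tx] := leP x tau.
  apply: (@le_trans _ _ (tau `^ p)).
    by apply: ge0_ler_powR => //; rewrite nnegrE// ltW.
  by rewrite lerDl mulr_ge0 ?sqr_ge0// ltW// divr_gt0// exprn_gt0.
have xp : 0 < x by exact: lt_trans tx.
have key : x `^ p / x ^+ 2 <= tau `^ p / tau ^+ 2.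
  have E z : 0 < z -> z `^ p / z ^+ 2 = (z `^ (2 - p))^-1.
    move=> z0; rewrite powRB; last by apply/implyP => _; rewrite gt_eqF.
    by rewrite powR_mulrn ?ltW// invf_div.
  rewrite !E// lef_pV2 ?posrE ?powR_gt0//.
  by apply: ge0_ler_powR; rewrite ?nnegrE; lra.
rewrite -[leLHS](@divfK _ (x ^+ 2)) ?expf_neq0 ?gt_eqF//.
apply: (@le_trans _ _ (tau `^ p / tau ^+ 2 * x ^+ 2)).
  by rewrite ler_wpM2r ?sqr_ge0.
by rewrite lerDr ltW.
Qed.

(** Convexity of the p-th power with weights a / (a + b) and b / (a + b).
    Summed over the steps of a partition it is Minkowski's inequality for
    arbitrary bounds a and b of the two norms. *)
Lemma powR_add_le p (x y a b : R) : 1 <= p ->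
  0 <= x -> 0 <= y -> 0 < a -> 0 < b ->
  (x + y) `^ p <= (a + b) `^ p *
     (a / (a + b) * (x `^ p / a `^ p) + b / (a + b) * (y `^ p / b `^ p)).
Proof.
move=> p1 x0 y0 a0 b0; have ab0 : 0 < a + b by rewrite addr_gt0.
have l01 : 0 <= a / (a + b) <= 1.
  by rewrite divr_ge0 ?(ltW a0) ?(ltW ab0)//= ler_pdivrMr// mul1r lerDl ltW.
have mem z : 0 <= z -> z \in (`[0, +oo[%classic : set R).
  by move=> z0; rewrite inE/= in_itv/= z0.
have [l0 l1] := andP l01.
have := convex_powR p1 (Itv01 l0 l1)
  (mem _ (divr_ge0 x0 (ltW a0))) (mem _ (divr_ge0 y0 (ltW b0))).
rewrite convRE [X in X `^ _ <= _ -> _]convRE/= => H.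
have e1 : 1 - a / (a + b) = b / (a + b).
  by rewrite -[1](@divff _ (a + b)) ?gt_eqF// -mulrBl addrAC subrr add0r.
rewrite /unstable.onem e1 in H.
have -> : x + y = (a + b) * (a / (a + b) * (x / a) + b / (a + b) * (y / b)).
  by field; rewrite !gt_eqF.
have [a0' b0' ab0'] : [/\ 0 <= a, 0 <= b & 0 <= a + b] by split; apply/ltW.
rewrite powRM//; last by rewrite addr_ge0// mulr_ge0// divr_ge0.
rewrite ler_wpM2l ?powR_ge0//.
have E z c : 0 <= z -> 0 < c -> z `^ p / c `^ p = (z / c) `^ p.
  move=> z0 c0; rewrite powRM// ?invr_ge0 ?ltW//; congr (_ * _).
  by rewrite -(powR_inv1 (ltW c0)) -powRrM mulrC powRrM powR_inv1// powR_ge0.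
by rewrite !E.
Qed.

(** The p-variation seminorm is at most A, stated with real numbers only so
    that bounds add up without passing through suprema. *)
Definition pvar_bound p (f : R -> R) (A : R) : Prop :=
  forall (m : nat) (t : nat -> R), 0 <= t 0%N ->
    (forall j, (j < m)%N -> t j < t j.+1) ->
    \sum_(j < m) `|f (t j.+1) - f (t j)| `^ p <= A `^ p.

Lemma partition_ge0 (m : nat) (t : nat -> R) : 0 <= t 0%N ->
  (forall j, (j < m)%N -> t j < t j.+1) -> forall j, (j <= m)%N -> 0 <= t j.
Proof.
move=> t0 tS; elim => [//|j IH] jm.
by rewrite (le_trans (IH (ltnW jm)))// ltW// tS.
Qed.

Lemma pvar_bound_eq p (f g : R -> R) A : (forall t, 0 <= t -> f t = g t) ->
  pvar_bound p f A -> pvar_bound p g A.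
Proof.
move=> fg H m t t0 tS; rewrite (le_trans _ (H m t t0 tS))//.
have tj := partition_ge0 t0 tS.
by apply: ler_sum => -[j jm] _ /=; rewrite !fg// tj// ltnW.
Qed.

Lemma pvar_bound_cst p (f : R -> R) A : 0 < p -> (forall t, 0 <= t -> f t = f
  0) ->
  pvar_bound p f A.
Proof.
move=> p0 f0 m t t0 tS; have tj := partition_ge0 t0 tS.
rewrite big1 ?powR_ge0// => -[j jm] _ /=.
by rewrite f0 ?tj// (f0 (t j)) ?tj ?(ltnW jm)// subrr normr0 powR0// gt_eqF.
Qed.

Lemma pvar_boundD p (f g : R -> R) (A B : R) : 1 <= p -> 0 < A -> 0 < B ->
  pvar_bound p f A -> pvar_bound p g B ->
  pvar_bound p (fun t => f t + g t) (A + B).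
Proof.
move=> p1 A0 B0 Hf Hg m t t0 tS.
have AB0 : 0 < A + B by rewrite addr_gt0.
pose c := (A + B) `^ p * (A / (A + B) / A `^ p).
pose d := (A + B) `^ p * (B / (A + B) / B `^ p).
apply: (@le_trans _ _ (\sum_(j < m) (c * `|f (t j.+1) - f (t j)| `^ p +
                                    d * `|g (t j.+1) - g (t j)| `^ p))).
  apply: ler_sum => j _; apply: (@le_trans _ _
    ((`|f (t j.+1) - f (t j)| + `|g (t j.+1) - g (t j)|) `^ p)).
    apply: ge0_ler_powR; rewrite ?nnegrE ?addr_ge0 ?normr_ge0//; first by lra.
    by rewrite (le_trans _ (ler_normD _ _))// opprD addrACA.
  apply: le_trans (powR_add_le p1 (normr_ge0 _) (normr_ge0 _) A0 B0) _.
  by rewrite /c /d; apply: eq_ler; ring.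
rewrite big_split/= -!mulr_sumr.
apply: (@le_trans _ _ (c * A `^ p + d * B `^ p)).
  apply: lerD; apply: ler_wpM2l; [|exact: Hf| |exact: Hg];
  by rewrite mulr_ge0 ?powR_ge0// !divr_ge0 ?powR_ge0 ?ltW.
have := powR_gt0 p A0; have := powR_gt0 p B0; rewrite /c /d => B1 A1.
by apply: eq_ler; field; rewrite !gt_eqF.
Qed.

Lemma pvar_bound_sum p (f : nat -> R -> R) (A : nat -> R)
    (g : R -> R) (B : R) (H : nat) : 1 <= p -> 0 < B ->
  (forall h, (h < H)%N -> 0 < A h /\ pvar_bound p (f h) (A h)) ->
  pvar_bound p g B ->
  pvar_bound p (fun t => g t + \sum_(h < H) f h t) (B + \sum_(h < H) A h).
Proof.
move=> p1 B0 + Hg; elim: H => [|H IH] Hf.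
  rewrite big_ord0 addr0; apply: pvar_bound_eq Hg => t _.
  by rewrite big_ord0 addr0.
have {}IH := IH (fun h hH => Hf h (ltnW hH)).
have [AH HH] := Hf H (ltnSn H).
rewrite big_ord_recr/= addrA.
apply: pvar_bound_eq (pvar_boundD p1 _ AH IH HH).
  by move=> t _; rewrite big_ord_recr/= addrA.
rewrite ltr_wpDr// sumr_ge0// => -[h hH] _; apply/ltW.
by have [] := Hf h (ltnW hH).
Qed.

(** Times are sorted into consecutive cells k j.  A step between two cells is
    charged to both of them, and as the cells are visited in order each is
    entered and left at most once.  Steps inside a cell are paid by a potential
    psi that stays below the weight of the cell. *)
Lemma cell_variation_bound p (L : nat) (y : nat -> R) (m : nat) (k : nat -> nat)
    (D psi : nat -> R) : 1 <= p < 2 -> (forall c, 0 <= y c) ->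
  (forall j, (j < m)%N -> (k j <= k j.+1)%N) ->
  (forall j, (j <= m)%N -> (k j < L)%N) ->
  (forall j, (j <= m)%N -> 0 <= psi j <= y (k j)) ->
  (forall j, (j <= m)%N -> `|D j| `^ p <= y (k j)) ->
  (forall j, (j < m)%N -> k j = k j.+1 ->
     `|D j.+1 - D j| `^ p + psi j <= psi j.+1) ->
  \sum_(j < m) `|D j.+1 - D j| `^ p <= 9 * \sum_(c < L) y c.
Proof.
move=> p12 y0 kS kL psiy Dy same.
have mono a b : (a <= b)%N -> \sum_(c < a) y c <= \sum_(c < b) y c.
  move=> ab; rewrite -(subnK ab); elim: (b - a)%N => [//|n IH].
  by rewrite addSn big_ord_recr/= (le_trans IH)// lerDl y0.
(* 4 y is kept in reserve for leaving the current cell; the second sum pays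
   for the potentials of the cells already left. *)
have main i : (i <= m)%N ->
  \sum_(j < i) `|D j.+1 - D j| `^ p + 4 * y (k i) <=
    8 * \sum_(c < (k i).+1) y c + \sum_(c < k i) y c + psi i.
  elim: i => [_|i IH im].
    have s0 : 0 <= \sum_(c < k 0%N) y c by apply: sumr_ge0.
    have := y0 (k 0%N); have /andP[] := psiy 0%N isT.
    by rewrite big_ord0 big_ord_recr/=; lra.
  have {}IH := IH (ltnW im).
  rewrite big_ord_recr/=; have [e|ne] := eqVneq (k i) (k i.+1).
    by have := same i im e; rewrite -e; lra.
  have kk : (k i < k i.+1)%N by rewrite ltn_neqAle ne kS.
  have c1 := le_trans (powR_dist_le4 (D i.+1) (D i) p12)
     (ler_wpM2l (ler0n _ _) (lerD (Dy _ im) (Dy _ (ltnW im)))).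
  have := mono _ _ kk; have /andP[_ +] := psiy i (ltnW im).
  have /andP[+ _] := psiy i.+1 im.
  move: IH c1; rewrite !big_ord_recr/=; lra.
have := main m (leqnn m); have /andP[_] := psiy m (leqnn m).
have := mono _ _ (kL m (leqnn m)).
have := y0 (k m); have := mono 0%N (k m) (leq0n _).
by rewrite big_ord0 !big_ord_recr/=; lra.
Qed.

End PowersAndVariation.

(** * Maxima of sequences through dyadic increments *)

Section DyadicMaximum.
Variable R : realType.
Implicit Types u : nat -> R.

(** The Rademacher-Menshov majorant of u on the dyadic interval of length 2^q
    that starts at a. *)
Fixpoint rm_bound (u : nat -> R) (q a : nat) : R :=
  (u (a + 2 ^ q)%N - u a) ^+ 2 +
  (if q is q'.+1 then rm_bound u q' a + rm_bound u q' (a + 2 ^ q')%N else 0).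

Lemma rm_bound_ge u q a : (u (a + 2 ^ q)%N - u a) ^+ 2 <= rm_bound u q a.
Proof.
have ge0 : forall r b, 0 <= rm_bound u r b.
  elim=> [|r IH] b /=; first by rewrite addr0 sqr_ge0.
  by rewrite addr_ge0 ?sqr_ge0// addr_ge0.
by case: q => [|q]/=; rewrite lerDl ?addr_ge0.
Qed.

(** Binary expansion writes the interval from a to a + n as a union of at most
    one dyadic block of each length, and Cauchy-Schwarz over these at most
    q + 1 blocks costs the factor q + 1.  Second moments of increments thus
    control the second moment of a maximum. *)
Lemma rm_boundP u q a n : (n <= 2 ^ q)%N ->
  (u (a + n)%N - u a) ^+ 2 <= q.+1%:R * rm_bound u q a.
Proof.
elim: q a n => [|q IH] a n.
  rewrite expn0 => n1; rewrite mul1r.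
  case: n n1 => [_|[|]//]; last by move=> _; exact: (rm_bound_ge u 0 a).
  by rewrite addn0 subrr expr0n /= addr0 sqr_ge0.
have q0 : 0 < (q.+1%:R : R) by rewrite ltr0Sn.
have ge1 := rm_bound_ge u q a; have ge2 := rm_bound_ge u q (a + 2 ^ q)%N.
have sq0 := sqr_ge0 (u (a + 2 ^ q)%N - u a).
have sq1 := sqr_ge0 (u (a + 2 ^ q + 2 ^ q)%N - u (a + 2 ^ q)%N).
have sq2 := sqr_ge0 (u (a + 2 ^ q.+1)%N - u a).
move=> nq; have [nq'|nq'] := leqP n (2 ^ q).
  apply: le_trans (IH a n nq') _ => /=.
  rewrite -[q.+2%:R]natr1; nra.
have [n' def_n] : exists n', n = (2 ^ q + n')%N.
  by exists (n - 2 ^ q)%N; rewrite subnKC// ltnW.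
have n'q : (n' <= 2 ^ q)%N.
  by move: nq; rewrite expnS def_n mul2n -addnn leq_add2l.
have := IH (a + 2 ^ q)%N n' n'q; rewrite def_n /= addnA.
set X := u (a + 2 ^ q + n')%N; set Y := u (a + 2 ^ q)%N.
move: ge1 ge2 sq2; rewrite -/Y; set V1 := rm_bound u q a.
set V2 := rm_bound u q _ => ge1 ge2;
  set T2 := (u (a + 2 ^ q.+1)%N - u a) ^+ 2 => sq2 XV.
rewrite -[q.+2%:R]natr1; move: q0 XV; set k := q.+1%:R => k0 XV.
(* (s + t)^2 <= (1 + 1/k) s^2 + (1 + k) t^2, cleared of its denominator. *)
have young : k * (X - u a) ^+ 2 <= (k + 1) * (X - Y) ^+ 2 + k * (k + 1) * (Y -
  u a) ^+ 2.
  rewrite -subr_ge0; set e := (leRHS).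
  have -> : e = ((X - Y) - k * (Y - u a)) ^+ 2 by rewrite /e; ring.
  exact: sqr_ge0.
rewrite -(ler_pM2l k0) (le_trans young)//.
have k1 : 0 < k + 1 by lra.
have kk1 : 0 < k * (k + 1) by rewrite mulr_gt0.
have h1 : (k + 1) * (X - Y) ^+ 2 <= (k + 1) * (k * V2) by rewrite ler_pM2l.
have h2 : k * (k + 1) * (Y - u a) ^+ 2 <= k * (k + 1) * V1 by rewrite ler_pM2l.
have h3 : 0 <= k * (k + 1) * T2 by rewrite mulr_ge0// ltW.
lra.
Qed.

End DyadicMaximum.

(** * Separated intervals and cofinal sequences *)

Section SeparatedIntervals.
Variable R : realType.

(** Increments of a monotone function over successive intervals telescope.
    Only intervals of positive length have to be in order, so that an empty
    cell may be represented by a one-point interval out of order. *)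
Lemma separated_increments (N : R -> R) (C : R) (a b : nat -> R) (L : nat) :
  (forall s t, 0 <= s -> s <= t -> N s <= N t) ->
  (forall t, 0 <= t -> 0 <= N t <= C) ->
  (forall c, 0 <= a c <= b c) ->
  (forall c c', (c < c' < L)%N -> a c < b c -> a c' < b c' -> b c <= a c') ->
  \sum_(c < L) (N (b c) - N (a c)) <= C.
Proof.
move=> Nmono NC ab sep.
have main x K : (K <= L)%N -> 0 <= x ->
    (forall c, (c < K)%N -> a c < b c -> b c <= x) ->
    \sum_(c < K) (N (b c) - N (a c)) <= N x.
  elim: K x => [|K IH] x KL x0 bx.
    by rewrite big_ord0; have /andP[] := NC x x0.
  rewrite big_ord_recr/=; have /andP[aK0 abK] := ab K.
  have [aK|bK] := ltP (a K) (b K).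
    have IHK := IH (a K) (ltnW KL) aK0 (fun c cK abc =>
      sep c K (introT andP (conj cK KL)) abc aK).
    have := Nmono (b K) x (le_trans aK0 abK) (bx K (ltnSn K) aK); lra.
  have <- : a K = b K by apply/le_anti; rewrite abK.
  rewrite subrr addr0; apply: IH => // [|c cK]; [exact: ltnW|exact/bx/ltnW].
have [x [x0 bx]] : exists x, 0 <= x /\ forall c, (c < L)%N -> b c <= x.
  elim: (L) => [|K [x [x0 bx]]]; first by exists 0.
  exists (Num.max x (b K)); rewrite le_max x0/=; split=> // c.
  rewrite ltnS leq_eqVlt => /predU1P[->|cK]; first by rewrite le_max lexx orbT.
  by rewrite le_max bx.
have /andP[_] := NC x x0; apply: le_trans.
by apply: main => // c cL _; exact: bx.
Qed.

Lemma sum_even_odd (n : nat) (F : nat -> R) :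
  \sum_(c < (n * 2)%N) F c = \sum_(c < n) F (c * 2)%N + \sum_(c < n) F (c * 2).+1.
Proof.
elim: n => [|n IH]; first by rewrite mul0n !big_ord0 addr0.
rewrite mulSn !addSn add0n 2!big_ord_recr/= IH [in RHS]big_ord_recr/=.
by rewrite [X in _ = _ + X]big_ord_recr/=; ring.
Qed.

(** The supremum of C may lie outside C.  The sequence is the running
    maximum, from r on, of the largest element of C, if there is one, and of one
    point of C beyond each rational number that has such a point. *)
Lemma cofinal_sequence (C : set R) (r : R) : C r ->
  exists u : nat -> R, [/\ u 0%N = r, forall k, C (u k),
    forall i j, (i <= j)%N -> u i <= u j & forall t, C t -> exists k, t <= u k].
Proof.
move=> Cr.
pose v k := if k is k'.+1 then
    (if unpickle k' is Some q then xget r [set x | C x /\ ratr (q : rat) < x]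
      else r)
  else xget r [set x | C x /\ forall y, C y -> y <= x].
have Cv k : C (v k).
  case: k => [|k] /=; first by case: xgetP => // x _ [].
  by case: unpickle => // q; case: xgetP => // x _ [].
pose fix u (k : nat) := if k is k'.+1 then Num.max (u k') (v k') else r.
exists u; split.
- by [].
- by elim=> [|k IH] //=; rewrite maxEle; case: ifP.
- move=> i j ij; rewrite -(subnK ij); elim: (j - i)%N => [//|n IH].
  by rewrite addSn /= le_max IH.
move=> t Ct; have vu k : v k <= u k.+1 by rewrite /= le_max lexx orbT.
have [[x [Cx tx]]|max_t] := pselect (exists x, C x /\ t < x).
  have [q /andP[tq qx]] := rat_in_itvoo tx.
  exists (pickle q).+2; apply: le_trans (vu _); rewrite /v pickleK.
  case: xgetP => [y _ [_ qy]|/(_ x)]; last by case.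
  exact/ltW/(lt_trans tq).
exists 1%N; apply: le_trans (vu _); rewrite /v.
case: xgetP => [y _ [_]|/(_ t) []]; first exact.
by split=> // y Cy; rewrite leNgt; apply/negP => ty; apply: max_t; exists y.
Qed.

End SeparatedIntervals.

(** * Degenerate U-statistics on finite product spaces *)

Section FiniteProduct.
Variables (R : realType) (E : finType) (mu : E -> R) (M : nat).
Hypothesis mu_ge0 : forall y, 0 <= mu y.
Hypothesis mu_sum1 : \sum_y mu y = 1.
Implicit Types (e : {ffun 'I_M -> E}) (Z W : {ffun 'I_M -> E} -> R).

Definition prod_weight e : R := \prod_i mu (e i).
Definition prod_mean Z : R := \sum_e prod_weight e * Z e.
Definition reset e (i : 'I_M) (y : E) : {ffun 'I_M -> E} :=
  [ffun k => if k == i then y else e k].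

Lemma prod_weight_ge0 e : 0 <= prod_weight e.
Proof. by apply: prodr_ge0 => i _. Qed.

Lemma prod_mean_sum (I : Type) (r : seq I) (P : pred I) (Z : I -> {ffun 'I_M ->
  E} -> R) :
  prod_mean (fun e => \sum_(k <- r | P k) Z k e) = \sum_(k <- r | P k)
    prod_mean (Z k).
Proof.
rewrite /prod_mean exchange_big/=; apply: eq_bigr => e _.
by rewrite mulr_sumr.
Qed.

Lemma prod_meanD Z W : prod_mean (fun e => Z e + W e) = prod_mean Z + prod_mean W.
Proof.
by rewrite /prod_mean -big_split/=; apply: eq_bigr => e _; rewrite mulrDr.
Qed.

(** Exchanging e i with an independent copy y is an involution of the pairs
    (e, y) that preserves their weight, so drawing the i-th coordinate afresh
    changes no mean.  All uses of independence go through this. *)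
Lemma prod_mean_resample (H : E -> {ffun 'I_M -> E} -> R) (i : 'I_M) :
  (forall y e z, H y (reset e i z) = H y e) ->
  prod_mean (fun e => H (e i) e) = \sum_y mu y * prod_mean (H y).
Proof.
move=> Hi; pose sw (ey : {ffun 'I_M -> E} * E) := (reset ey.1 i ey.2, ey.1 i).
have swK : involutive sw.
  move=> [e y]; rewrite /sw/=; congr pair; last by rewrite ffunE eqxx.
  by apply/ffunP => k; rewrite !ffunE; case: eqVneq => // ->.
transitivity (\sum_ey prod_weight ey.1 * mu ey.2 * H (ey.1 i) ey.1).
  rewrite -(pair_bigA _ (fun e y => prod_weight e * mu y * H (e i) e))/=.
  apply: eq_bigr => e _; rewrite -[LHS]mulr1 -mu_sum1 mulr_sumr.
  by apply: eq_bigr => y _; rewrite mulrAC.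
rewrite (reindex_inj (inv_inj swK))/=.
transitivity (\sum_ey mu ey.2 * (prod_weight ey.1 * H ey.2 ey.1)); last first.
  rewrite -(pair_bigA _ (fun e y => mu y * (prod_weight e * H y e)))/=.
  by rewrite exchange_big/=; apply: eq_bigr => y _; rewrite mulr_sumr.
apply: eq_bigr => -[e y] _ /=; rewrite Hi ffunE eqxx mulrA; congr (_ * _).
rewrite /prod_weight (bigD1 i)//= [in RHS](bigD1 i)//= ffunE eqxx.
rewrite [X in _ * X * _](_ : _ = \prod_(j | j != i) mu (e j)); first by ring.
by apply: eq_bigr => j /negbTE ji; rewrite ffunE ji.
Qed.

Lemma prod_mean_indep (phi : E -> R) Z (i : 'I_M) :
  (forall e z, Z (reset e i z) = Z e) ->
  prod_mean (fun e => phi (e i) * Z e) = (\sum_y mu y * phi y) * prod_mean Z.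
Proof.
move=> Zi; rewrite (prod_mean_resample (H := fun y e => phi y * Z e)).
  rewrite mulr_suml; apply: eq_bigr => y _.
  by rewrite -mulrA /prod_mean; congr (_ * _); rewrite mulr_sumr;
    apply: eq_bigr => e _; rewrite mulrCA.
by move=> y e z; rewrite Zi.
Qed.

Lemma prod_mean1 : prod_mean (fun=> 1) = 1.
Proof.
rewrite /prod_mean (eq_bigr (fun e => \prod_i mu (e i))); last first.
  by move=> e _; rewrite mulr1.
by rewrite -(bigA_distr_bigA (fun _ : 'I_M => mu)) big1.
Qed.

Lemma prod_mean_pair (G : E -> E -> R) (i j : 'I_M) : i != j ->
  prod_mean (fun e => G (e i) (e j)) = \sum_a mu a * \sum_b mu b * G a b.
Proof.
move=> ij; rewrite (prod_mean_resample (H := fun y e => G y (e j))); last first.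
  by move=> y e z; rewrite ffunE eq_sym (negbTE ij).
apply: eq_bigr => a _; congr (_ * _).
rewrite -[RHS]mulr1 -prod_mean1 -(@prod_mean_indep _ _ j)//.
by congr prod_mean; apply/funext => e; rewrite mulr1.
Qed.

Lemma prod_mean_sqr_sum (I : finType) (P : pred I) (z : I -> {ffun 'I_M -> E}
  -> R) :
  (forall j k, P j -> P k -> j != k -> prod_mean (fun e => z j e * z k e) = 0) ->
  prod_mean (fun e => (\sum_(k | P k) z k e) ^+ 2) =
  \sum_(k | P k) prod_mean (fun e => z k e ^+ 2).
Proof.
move=> orth.
have -> : (fun e => (\sum_(k | P k) z k e) ^+ 2) =
    (fun e => \sum_(j | P j) \sum_(k | P k) z j e * z k e).
  by apply/funext => e; rewrite expr2 mulr_suml; apply: eq_bigr => j _;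
    rewrite mulr_sumr.
rewrite prod_mean_sum; apply: eq_bigr => j Pj.
rewrite prod_mean_sum (bigD1 j)//= big1 ?addr0//.
by move=> k /andP[Pk kj]; rewrite orth// eq_sym.
Qed.

Section UStatistic.
Variables (L : nat) (X : 'I_L -> E -> R) (gam : R).
Hypothesis X_centered : forall c, \sum_y mu y * X c y = 0.
Definition gram (a b : E) : R := \sum_c X c a * X c b.
Hypothesis gram_sqr : \sum_a mu a * (\sum_b mu b * gram a b ^+ 2) <= gam.

(** Off-diagonal part of the squared norm of the sum of the vectors
    (X c (e i))_c: a degenerate U-statistic, whose partial sums form a
    martingale. *)
Definition ustat_term (i : 'I_M) e : R :=
  \sum_(j < M | (j < i)%N) gram (e j) (e i).
Definition ustat (e : {ffun 'I_M -> E}) (n : nat) : R :=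
  \sum_(i < M | (i < n)%N) ustat_term i e.

(** Averaging over the i-th coordinate alone gives zero, since X is centered. *)
Lemma prod_mean_gram_indep (i j : 'I_M) Z : i != j ->
  (forall e z, Z (reset e i z) = Z e) ->
  prod_mean (fun e => gram (e i) (e j) * Z e) = 0.
Proof.
move=> ij Zi.
have -> : (fun e => gram (e i) (e j) * Z e) =
    (fun e => \sum_c X c (e i) * (X c (e j) * Z e)).
  apply/funext => e; rewrite mulr_suml.
  by apply: eq_bigr => c _; rewrite mulrA.
rewrite prod_mean_sum big1// => c _.
rewrite (@prod_mean_indep (X c) (fun e => X c (e j) * Z e)) ?X_centered ?mul0r//.
by move=> e z; rewrite Zi ffunE eq_sym (negbTE ij).
Qed.

Lemma gram_sym a b : gram a b = gram b a.
Proof. by apply: eq_bigr => c _; rewrite mulrC. Qed.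

Lemma ustat_term_sqr (i : 'I_M) :
  prod_mean (fun e => ustat_term i e ^+ 2) <= M%:R * gam.
Proof.
rewrite prod_mean_sqr_sum; last first.
  move=> j k ji ki jk; apply: prod_mean_gram_indep.
    by rewrite neq_ltn ji.
  move=> e z; rewrite !ffunE (eq_sym k) (negbTE jk).
  by have -> : (i == j) = false by apply/eqP => ij; rewrite ij ltnn in ji.
have gam0 : 0 <= gam.
  apply: le_trans gram_sqr; apply: sumr_ge0 => a _; rewrite mulr_ge0//.
  by apply: sumr_ge0 => b _; rewrite mulr_ge0// sqr_ge0.
apply: (@le_trans _ _ (\sum_(j < M) gam)); last first.
  by rewrite sumr_const card_ord mulr_natl.
rewrite big_mkcond/=; apply: ler_sum => j _; case: ifP => // ji.
rewrite (@prod_mean_pair (fun a b => gram a b ^+ 2))//.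
by rewrite neq_ltn ji.
Qed.

(** The terms gram (e j) (e i) with j < i are pairwise orthogonal: two
    different pairs of indices always leave an index that occurs only once. *)
Lemma ustat_increment a b : (a <= b)%N ->
  prod_mean (fun e => (ustat e b - ustat e a) ^+ 2) <= (b - a)%:R * (M%:R * gam).
Proof.
move=> ab.
have -> : (fun e => (ustat e b - ustat e a) ^+ 2) =
    (fun e => (\sum_(i < M | (a <= i < b)%N) ustat_term i e) ^+ 2).
  apply/funext => e; congr (_ ^+ 2).
  rewrite /ustat (bigID (fun i : 'I_M => (i < a)%N))/= addrC.
  rewrite (eq_bigl (fun i : 'I_M => (a <= i < b)%N)); last first.
    by move=> i; rewrite -leqNgt andbC.
  rewrite [X in _ + X - _](eq_bigl (fun i : 'I_M => (i < a)%N)) ?addrK//.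
  by move=> i; apply: andb_idl => /leq_trans; exact.
rewrite prod_mean_sqr_sum; last first.
  have orth (j k : 'I_M) : (k < j)%N ->
      prod_mean (fun e => ustat_term j e * ustat_term k e) = 0.
    move=> kj.
    have -> : (fun e => ustat_term j e * ustat_term k e) =
       (fun e => \sum_(l < M | (l < j)%N) gram (e j) (e l) * ustat_term k e).
      apply/funext => e; rewrite mulr_suml; apply: eq_bigr => l _.
      by rewrite gram_sym.
    rewrite prod_mean_sum big1// => l lj; apply: prod_mean_gram_indep.
      by rewrite neq_ltn lj orbT.
    move=> e z; apply: eq_bigr => l' l'k; rewrite !ffunE.
    have -> : (k == j) = false by apply/eqP => kj'; rewrite kj' ltnn in kj.
    have -> : (l' == j) = false by apply/eqP => lj'; move: (ltn_trans l'k kj);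
      rewrite lj' ltnn.
    by [].
  move=> j k _ _; rewrite neq_ltn => /orP[jk|kj]; last exact: orth.
  rewrite -(orth _ _ jk); congr prod_mean.
  by apply/funext => e; rewrite mulrC.
apply: (@le_trans _ _ (\sum_(i < M | (a <= i < b)%N) (M%:R * gam))).
  by apply: ler_sum => i _; exact: ustat_term_sqr.
have gam0 : 0 <= M%:R * gam.
  rewrite mulr_ge0//; apply: le_trans gram_sqr.
  apply: sumr_ge0 => y _; rewrite mulr_ge0//.
  by apply: sumr_ge0 => z _; rewrite mulr_ge0// sqr_ge0.
rewrite big_const_seq iter_addr_0 -[leLHS]mulr_natl ler_wpM2r// ler_nat.
rewrite -[X in (_ <= X)%N](size_iota a (b - a)).
rewrite -size_filter -(size_map val).
apply: uniq_leq_size.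
  by rewrite map_inj_uniq ?filter_uniq ?index_enum_uniq//; exact: val_inj.
move=> x /mapP[i]; rewrite mem_filter => /andP[iab _] ->.
by rewrite mem_iota subnKC.
Qed.

Lemma rm_bound_mean q a : prod_mean (fun e => rm_bound (ustat e) q a) <=
  q.+1%:R * (2 ^ q)%:R * (M%:R * gam).
Proof.
have top r b := ustat_increment (leq_addr (2 ^ r) b).
elim: q a => [|q IH] a.
  have -> : (fun e => rm_bound (ustat e) 0 a) =
      (fun e => (ustat e (a + 2 ^ 0)%N - ustat e a) ^+ 2).
    by apply/funext => e; rewrite /= addr0.
  by apply: (le_trans (top 0%N a)); rewrite addKn expn0 !mul1r.
rewrite /= 2!prod_meanD (le_trans (lerD (top q.+1 a) (lerD (IH a) (IH (a + 2 ^
  q)%N))))//.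
rewrite addKn expnS natrM -[q.+2%:R]natr1 ; apply: eq_ler; ring.
Qed.

(** Chebyshev's inequality for the Rademacher-Menshov majorant, which controls
    all partial sums at once. *)
Lemma ustat_max_tail q (tau : R) : 0 < tau -> M = (2 ^ q)%N ->
  \sum_(e | [exists n : 'I_(2 ^ q).+1, tau < `|ustat e n|]) prod_weight e
   <= q.+1%:R ^+ 2 * (2 ^ q)%:R ^+ 2 * gam / tau ^+ 2.
Proof.
move=> tau0 Mq; have tau2 : 0 < tau ^+ 2 by rewrite exprn_gt0.
rewrite ler_pdivlMr//.
apply: (@le_trans _ _ (q.+1%:R * prod_mean (fun e => rm_bound (ustat e) q 0)));
  last first.
  rewrite (le_trans (ler_wpM2l (ler0n _ _) (rm_bound_mean q 0)))// Mq.
  by apply: eq_ler; ring.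
rewrite mulr_suml /prod_mean mulr_sumr big_mkcond/=; apply: ler_sum => e _.
have rm0 : 0 <= rm_bound (ustat e) q 0 := le_trans (sqr_ge0 _) (rm_bound_ge _ _
  _).
case: ifP => [/existsP[n taun]|_]; last first.
  by rewrite !mulr_ge0// prod_weight_ge0.
rewrite [leRHS]mulrCA ler_wpM2l ?prod_weight_ge0//.
have := @rm_boundP _ (ustat e) q 0 n (ltn_ord n); apply: le_trans.
have -> : ustat e 0%N = 0 by rewrite /ustat big_pred0.
rewrite subr0 add0n -(real_normK (num_real (ustat e n))).
by rewrite ler_sqr ?nnegrE ?normr_ge0//; apply/ltW.
Qed.

End UStatistic.

Section Gram.
Variables (L : nat) (Y : 'I_L -> E -> R) (S phi : R).
Let f c := \sum_y mu y * Y c y.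
Hypothesis Y_ge0 : forall c y, mu y != 0 -> 0 <= Y c y.
Hypothesis Y_sum : forall y, mu y != 0 -> \sum_c Y c y <= S.
Hypothesis f_le : forall c, f c <= phi.
Hypothesis phi_ge0 : 0 <= phi.

(** Replacing Y - f by Y + f, the inner product of two independent copies is
    at most 4 S^2 while its mean factorizes into the sum of the (2 f c)^2,
    which is at most 4 phi S.  The square of a quantity bounded by 4 S^2 has
    mean at most 4 S^2 times the mean: hence the gain of one factor phi, which
    makes fine levels concentrate. *)
Lemma centered_gram_sqr :
  \sum_a mu a * (\sum_b mu b * gram (fun c y => Y c y - f c) a b ^+ 2)
   <= 16 * S ^+ 3 * phi.
Proof.
have wle (P Q : E -> R) : (forall y, mu y != 0 -> P y <= Q y) ->
    \sum_y mu y * P y <= \sum_y mu y * Q y.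
  move=> PQ; apply: ler_sum => y _; have [->|y0] := eqVneq (mu y) 0.
    by rewrite !mul0r.
  by rewrite ler_wpM2l// PQ.
have w1 (r : R) : \sum_y mu y * r = r by rewrite -mulr_suml mu_sum1 mul1r.
have f0 c : 0 <= f c.
  rewrite -(w1 0); apply: wle => y y0; exact: Y_ge0.
have fS : \sum_c f c <= S.
  rewrite /f exchange_big/= -(w1 S).
  by under eq_bigr do rewrite -mulr_sumr; exact: wle.
have S0 : 0 <= S by apply: le_trans fS; apply: sumr_ge0.
pose G a b := \sum_c (Y c a + f c) * (Y c b + f c).
have Ysum y : mu y != 0 -> \sum_c (Y c y + f c) <= 2 * S.
  by move=> y0; rewrite big_split/=; have := Y_sum y0; lra.
have G4 a b : mu a != 0 -> mu b != 0 -> 0 <= G a b <= 4 * S ^+ 2.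
  move=> a0 b0; have ge c y : mu y != 0 -> 0 <= Y c y + f c.
    by move=> y0; rewrite addr_ge0// Y_ge0.
  rewrite sumr_ge0/= => [|c _]; last by rewrite mulr_ge0 ?ge.
  apply: (@le_trans _ _ (\sum_c (Y c a + f c) * (2 * S))).
    apply: ler_sum => c _; rewrite ler_wpM2l ?ge//; apply: le_trans (Ysum b b0).
    by rewrite (bigD1 c)//= lerDl sumr_ge0// => k _; rewrite ge.
  rewrite -mulr_suml (le_trans (ler_wpM2r _ (Ysum a a0)))//; nra.
have gramG a b : mu a != 0 -> mu b != 0 ->
    gram (fun c y => Y c y - f c) a b ^+ 2 <= 4 * S ^+ 2 * G a b.
  move=> a0 b0; have /andP[G0 GS] := G4 a b a0 b0.
  have gG : `|gram (fun c y => Y c y - f c) a b| <= G a b.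
    apply: (le_trans (ler_norm_sum _ _ _)); apply: ler_sum => c _.
    rewrite normrM; apply: ler_pM => //.
      by have := Y_ge0 c a0; have := f0 c; rewrite ler_norml => ? ?;
        apply/andP; split; lra.
    by have := Y_ge0 c b0; have := f0 c; rewrite ler_norml => ? ?; apply/andP;
      split; lra.
  rewrite -(real_normK (num_real _)) expr2.
  by apply: ler_pM => //; exact: le_trans gG GS.
apply: (@le_trans _ _ (\sum_a mu a * (\sum_b mu b * (4 * S ^+ 2 * G a b)))).
  by apply: (wle) => a a0; apply: (wle) => b b0; exact: gramG.
have meanG : \sum_a mu a * (\sum_b mu b * G a b) = \sum_c (2 * f c) ^+ 2.
  have plusf c : \sum_y mu y * (Y c y + f c) = 2 * f c.
    by under eq_bigr do rewrite mulrDr; rewrite big_split/= w1 -/(f c); ring.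
  transitivity (\sum_c (\sum_a mu a * (Y c a + f c)) * (\sum_b mu b * (Y c b +
    f c))).
    under eq_bigr => a _.
      have -> : \sum_b mu b * G a b =
          \sum_c (Y c a + f c) * \sum_b mu b * (Y c b + f c).
        under eq_bigr => b _ do rewrite mulr_sumr.
        rewrite exchange_big/=; apply: eq_bigr => c _; rewrite mulr_sumr.
        by apply: eq_bigr => b _; rewrite mulrCA.
      rewrite mulr_sumr; over.
    rewrite exchange_big/=; apply: eq_bigr => c _; rewrite mulr_suml.
    by apply: eq_bigr => a _; rewrite mulrA.
  by apply: eq_bigr => c _; rewrite plusf expr2.
have -> : \sum_a mu a * (\sum_b mu b * (4 * S ^+ 2 * G a b)) =
    4 * S ^+ 2 * \sum_c (2 * f c) ^+ 2.
  rewrite -meanG mulr_sumr; apply: eq_bigr => a _; rewrite [RHS]mulrCA;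
    congr (_ * _).
  by rewrite mulr_sumr; apply: eq_bigr => b _; rewrite [LHS]mulrCA.
have fphi : \sum_c (2 * f c) ^+ 2 <= 4 * phi * \sum_c f c.
  rewrite mulr_sumr; apply: ler_sum => c _.
  have := f0 c; have := f_le c; nra.
have h1 := ler_wpM2l (mulr_ge0 (ler0n R 4) (sqr_ge0 S)) fphi.
have h2 := ler_wpM2l (mulr_ge0 (mulr_ge0 (ler0n R 4) (sqr_ge0 S))
  (mulr_ge0 (ler0n R 4) phi_ge0)) fS.
by apply: (le_trans h1); rewrite mulrA (le_trans h2)//; apply: eq_ler; ring.
Qed.
End Gram.
End FiniteProduct.

(** * Nested cells of time cut out by the mean function *)

Section Cells.
Variables (R : realType) (F : R -> R) (B : R).
Hypothesis B_gt0 : 0 < B.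
Hypothesis F_mono : forall s t, 0 <= s -> s <= t -> F s <= F t.
Hypothesis F_le : forall t, 0 <= t -> 0 <= F t <= B.

Lemma ltr_B1 : 0 < B + 1. Proof. by rewrite addr_gt0. Qed.
Let B1_ge0 : 0 <= B + 1 := ltW ltr_B1.

(** Cells are level sets of the mean function on the scale 2^-h.  Reading them
    off the values of F rather than cutting time at quantiles makes atoms of F
    harmless: two times of one cell always have close values of F.  Dividing
    by B + 1 rather than B keeps the number of the cell below 2^h. *)
Definition cell (h : nat) (t : R) : nat :=
  Num.truncn ((2 ^ h)%:R * (F t / (B + 1))).

Lemma cellP h t c : 0 <= t ->
  (cell h t == c) = (c%:R <= (2 ^ h)%:R * (F t / (B + 1)) < c.+1%:R).
Proof.
move=> t0; rewrite /cell; apply: truncn_eq.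
have /andP[F0 _] := F_le t0.
by rewrite mulr_ge0// divr_ge0.
Qed.

Lemma cell_lt h t : 0 <= t -> (cell h t < 2 ^ h)%N.
Proof.
move=> t0; have := eqxx (cell h t); rewrite cellP// => /andP[+ _].
have /andP[F0 FB] := F_le t0.
have B1 := ltr_B1.
have lt1 : F t / (B + 1) < 1 by rewrite ltr_pdivrMr//; lra.
rewrite -(ltr_nat R) => /le_lt_trans; apply.
by rewrite -[ltRHS]mulr1 ltr_pM2l// ltr0n expn_gt0.
Qed.

Lemma cell_mono h s t : 0 <= s -> s <= t -> (cell h s <= cell h t)%N.
Proof.
move=> s0 st; rewrite /cell; apply: le_truncn; rewrite ler_wpM2l//.
by rewrite ler_pM2r ?F_mono// invr_gt0 ltr_B1.
Qed.

Lemma cell_half h t : 0 <= t -> cell h t = (cell h.+1 t)./2.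
Proof.
move=> t0; apply/eqP; rewrite cellP//.
have := eqxx (cell h.+1 t); rewrite cellP//.
set c := cell h.+1 t; set g := F t / (B + 1).
rewrite expnS natrM -mulrA; set x := _%:R * g => /andP[cx xc].
have cE := odd_double_half c.
have h1 : (c./2.*2)%:R <= (c%:R : R) by rewrite ler_nat -[leqRHS]cE leq_addl.
have h2 : (c.+1%:R : R) <= (c./2.*2.+2)%:R.
  by rewrite ler_nat -[in leqLHS]cE; case: (odd c); rewrite ltnS ?add1n// ltnW.
rewrite -muln2 natrM in h1; rewrite -doubleS -muln2 natrM in h2.
by apply/andP; split; lra.
Qed.

Lemma cell_le_F h s t : 0 <= s -> 0 <= t -> cell h s = cell h t ->
  F t - F s <= (B + 1) / (2 ^ h)%:R.
Proof.
move=> s0 t0 st; have := eqxx (cell h s); rewrite cellP// => /andP[cs _].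
have := eqxx (cell h t); rewrite cellP// -st => /andP[_ ct].
have B1 := ltr_B1.
have e0 : 0 < ((2 ^ h)%:R : R) by rewrite ltr0n expn_gt0.
rewrite ler_pdivlMr//.
have : (2 ^ h)%:R * (F t / (B + 1)) - (2 ^ h)%:R * (F s / (B + 1)) <= 1.
  by move: cs ct; rewrite -natr1; lra.
rewrite -mulrBr -mulrBl mulrA ler_pdivrMr// mul1r mulrC => H.
exact: H.
Qed.

Definition cell_rep (h c : nat) : R := xget 0 [set t | 0 <= t /\ cell h t = c].
Definition nearby (h : nat) (t : R) : R := cell_rep h (cell h t).

Lemma cell_rep_ge0 h c : 0 <= cell_rep h c.
Proof. by rewrite /cell_rep; case: xgetP => // t _ []. Qed.

Lemma cell_nearby h t : 0 <= t -> cell h (nearby h t) = cell h t.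
Proof.
move=> t0; rewrite /nearby /cell_rep; case: xgetP => [s _ []//|/(_ t)].
by case.
Qed.

(** The chaining step from level h to level h.+1 inside the cell c of level
    h.+1 joins the representative of that cell to the one of its parent cell.
    Empty cells get the degenerate link from 0 to 0. *)
Definition link_start (h c : nat) : R :=
  let t := cell_rep h.+1 c in if cell h.+1 t == c then t else 0.
Definition link_end (h c : nat) : R :=
  let t := cell_rep h.+1 c in if cell h.+1 t == c then nearby h t else 0.
Definition link_min h c := Num.min (link_start h c) (link_end h c).
Definition link_max h c := Num.max (link_start h c) (link_end h c).

Lemma link_bounds h c : 0 <= link_min h c <= link_max h c.
Proof.
have s0 : 0 <= link_start h c.
  by rewrite /link_start; case: ifP => // _; exact: cell_rep_ge0.
have e0 : 0 <= link_end h c.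
  by rewrite /link_end; case: ifP => // _; exact: cell_rep_ge0.
by rewrite le_min s0 e0 ge_min le_max lexx.
Qed.

Lemma link_cells h c : link_min h c < link_max h c ->
  cell h (link_min h c) = c./2 /\ cell h (link_max h c) = c./2.
Proof.
rewrite /link_min /link_max /link_start /link_end.
set t := cell_rep _ _; case: eqP => [tc|_]; last by rewrite minxx maxxx ltxx.
have t0 : 0 <= t by exact: cell_rep_ge0.
have e : cell h t = c./2 by rewrite cell_half// tc.
have e' : cell h (nearby h t) = c./2 by rewrite cell_nearby.
by rewrite minEle maxEle; case: ifP.
Qed.

Lemma link_F h c : F (link_max h c) - F (link_min h c) <= (B + 1) / (2 ^ h)%:R.
Proof.
have /andP[m0 mM] := link_bounds h c.
have [lt|ge] := ltP (link_min h c) (link_max h c).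
  by have [e1 e2] := link_cells lt; rewrite cell_le_F ?e1 ?e2// (le_trans m0).
have <- : link_min h c = link_max h c by apply/le_anti; rewrite mM.
by rewrite subrr divr_ge0.
Qed.

(** A link stays inside the parent cell, and a parent has two children: the
    links of even number are separated, and so are those of odd number. *)
Lemma link_increments (N : R -> R) (C : R) h :
  (forall s t, 0 <= s -> s <= t -> N s <= N t) ->
  (forall t, 0 <= t -> 0 <= N t <= C) ->
  \sum_(c < 2 ^ h.+1) (N (link_max h c) - N (link_min h c)) <= 2 * C.
Proof.
move=> Nmono NC; rewrite expnSr.
rewrite (sum_even_odd _ (fun c => N (link_max h c) - N (link_min h c))).
have sep (k : nat -> nat) : (forall c, (k c)./2 = c) ->
    \sum_(c < 2 ^ h) (N (link_max h (k c)) - N (link_min h (k c))) <= C.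
  move=> k2; apply: (@separated_increments _ _ _ (link_min h \o k) (link_max h
    \o k)) => //=.
    by move=> c; exact: link_bounds.
  move=> c c' /andP[cc' _] /link_cells[_ c1] /link_cells[c2 _].
  have /andP[m0 _] := link_bounds h (k c');
    have /andP[m1 m2] := link_bounds h (k c).
  rewrite leNgt; apply/negP => /ltW /(cell_mono h m0).
  by rewrite c1 c2 !k2 leqNgt cc'.
rewrite mulr_natl mulr2n lerD//.
  by apply: (sep (fun c => c * 2)%N) => c; rewrite muln2 doubleK.
by apply: (sep (fun c => (c * 2).+1)%N) => c; rewrite muln2 /= uphalf_double.
Qed.

Lemma link_dist (f : R -> R) h t : 0 <= t ->
  `|f (nearby h.+1 t) - f (nearby h t)| =
  `|f (link_max h (cell h.+1 t)) - f (link_min h (cell h.+1 t))|.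
Proof.
move=> t0; rewrite /link_max /link_min /link_start /link_end -/(nearby h.+1 t).
rewrite cell_nearby// eqxx.
have -> : nearby h (nearby h.+1 t) = nearby h t.
  rewrite /nearby; congr cell_rep; rewrite !(@cell_half h) ?cell_rep_ge0//.
  by rewrite -/(nearby h.+1 t) cell_nearby.
by rewrite minEle maxEle; case: ifP => // _; rewrite distrC.
Qed.

(** A cell need not contain its right end, since F may jump there, and then no
    closed interval inside the cell may carry all the increments that paths have
    in the cell.  The extent of each cell is therefore exhausted by closed
    intervals that grow with k. *)
Lemma brackets h : exists l u : nat -> nat -> R,
  [/\ forall c k, 0 <= l c k <= u c k,
      forall c k, F (u c k) - F (l c k) <= (B + 1) / (2 ^ h)%:R,
      forall c i j, (i <= j)%N -> l c j <= l c i /\ u c i <= u c j,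
      forall t, 0 <= t -> l (cell h t) 0%N <= nearby h t <= u (cell h t) 0%N &
      (forall t, 0 <= t -> exists k, l (cell h t) k <= t <= u (cell h t) k) /\
      (forall (N : R -> R) (C : R) k,
        (forall s t, 0 <= s -> s <= t -> N s <= N t) ->
        (forall t, 0 <= t -> 0 <= N t <= C) ->
        \sum_(c < 2 ^ h) (N (u c k) - N (l c k)) <= C)].
Proof.
have one c : exists lu : (nat -> R) * (nat -> R),
  [/\ forall k, 0 <= lu.1 k <= lu.2 k,
      forall k, lu.1 k < lu.2 k -> cell h (lu.1 k) = c /\ cell h (lu.2 k) = c,
      forall i j, (i <= j)%N -> lu.1 j <= lu.1 i /\ lu.2 i <= lu.2 j,
      forall t, 0 <= t -> cell h t = c -> lu.1 0%N <= cell_rep h c <= lu.2 0%N &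
      (forall t, 0 <= t -> cell h t = c -> exists k, lu.1 k <= t <= lu.2 k)].
  pose r := cell_rep h c; have r0 : 0 <= r by exact: cell_rep_ge0.
  have [rc|rc] := eqVneq (cell h r) c; last first.
    exists (fun=> 0, fun=> 0) => /=; split=> //.
    - by move=> k; rewrite lexx.
    - by move=> k; rewrite ltxx.
    - move=> t t0 tc; move: rc; rewrite /r -tc -/(nearby h t) cell_nearby//.
      by rewrite eqxx.
    - move=> t t0 tc; move: rc; rewrite /r -tc -/(nearby h t) cell_nearby//.
      by rewrite eqxx.
  have [u [u0 uC uS ucof]] := @cofinal_sequence R [set t | 0 <= t /\ cell h t =
    c] r (conj r0 rc).
  have [l [l0 lC lS lcof]] := @cofinal_sequence R [set t | 0 <= - t /\ cell h
    (- t) = c] (- r)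
    ltac:(by rewrite /= opprK).
  exists (fun k => - l k, u) => /=; split.
  - move=> k; have [-> _] := lC k; rewrite /= (@le_trans _ _ r)//.
      by rewrite lerNl -l0 lS.
    by rewrite -u0 uS.
  - by move=> k _; have [] := lC k; have [] := uC k.
  - by move=> i j ij; rewrite lerN2 lS ?uS.
  - by move=> t _ _; rewrite u0 l0 opprK !lexx.
  - move=> t t0 tc; have [k1 tk1] := ucof t (conj t0 tc).
    have [k2 tk2] := lcof (- t) ltac:(by rewrite /= opprK).
    exists (k1 + k2)%N; rewrite lerNl (le_trans tk2) ?lS ?leq_addl//=.
    by rewrite (le_trans tk1)// uS// leq_addr.
have [lu luP] := choice one.
exists (fun c => (lu c).1), (fun c => (lu c).2); split.
- by move=> c k; have [+ _ _ _ _] := luP c; exact.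
- move=> c k; have [/(_ k)/andP[l0 lk] /(_ k) lc _ _ _] := luP c.
  have [lt|ge] := ltP ((lu c).1 k) ((lu c).2 k).
    by have [e1 e2] := lc lt; rewrite cell_le_F ?e1 ?e2// (le_trans l0).
  have <- : (lu c).1 k = (lu c).2 k by apply/le_anti; rewrite lk.
  by rewrite subrr divr_ge0.
- by move=> c; have [_ _ + _ _] := luP c; exact.
- by move=> t t0; have [_ _ _ + _] := luP (cell h t); move=> /(_ t t0 erefl).
split; first by move=> t t0; have [_ _ _ _ +] := luP (cell h t);
  move=> /(_ t t0 erefl).
move=> N C k Nmono NC.
apply: (@separated_increments _ _ _ (fun c => (lu c).1 k) (fun c => (lu c).2
  k)) => //.
  by move=> c; have [+ _ _ _ _] := luP c; exact.
move=> c c' /andP[cc' _].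
have [/(_ k)/andP[l0 lk] /(_ k) lc _ _ _] := luP c.
have [/(_ k)/andP[l0' lk'] /(_ k) lc' _ _ _] := luP c'.
move=> /lc[_ e1] /lc'[e2 _].
rewrite leNgt; apply/negP => /ltW /(cell_mono h l0').
by rewrite e1 e2 leqNgt cc'.
Qed.

End Cells.

(** * Chaining over the levels *)

Section Rate.
Variables (R : realType) (p : R).
Hypothesis p12 : 1 <= p < 2.
Let p_gt0 : 0 < p. Proof. by move: p12 => /andP[]; lra. Qed.

(** The exponent is half of 1/p - 1/2, positive exactly because p < 2.  At the
    k-th level above the finest one the sum of squared deviations is allowed
    to exceed its mean by the factor rate^(2k), and its contribution to the
    p-variation seminorm is still smaller than that of the finest level by the
    factor rate^k. *)
Definition rate : R := 2 `^ ((p^-1 - 2^-1) / 2).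

Lemma rate_gt1 : 1 < rate.
Proof.
have /andP[p1 p2] := p12.
have : 2^-1 < p^-1 by rewrite ltf_pV2 ?posrE.
rewrite /rate => h; rewrite -[ltLHS](powRr0 2) lt_neqAle ler_powR ?andbT; try lra.
apply/eqP => /(congr1 (@ln R)); rewrite !ln_powR mul0r.
have : 0 < ln (2 : R) by rewrite ln_gt0//; lra.
nra.
Qed.

Let rate_gt0 : 0 < rate := lt_trans ltr01 rate_gt1.

Lemma rate4_le2 : rate ^+ 4 <= 2.
Proof.
have /andP[p1 p2] := p12; have : p^-1 <= 1 by rewrite invf_le1.
move=> h; rewrite -(powR_mulrn 4 (ltW rate_gt0)) /rate -powRrM.
rewrite -[leRHS]powRr1//; apply: ler_powR; lra.
Qed.

Let z : R := 2 `^ 2^-1 * rate.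
Let z_gt0 : 0 < z. Proof. by rewrite mulr_gt0// powR_gt0. Qed.

Let z2 : z ^+ 2 = 2 * rate ^+ 2.
Proof.
rewrite /z exprMn; congr (_ * _).
by rewrite -powR_mulrn ?powR_ge0// -powRrM mulVf// powRr1.
Qed.

Let zp : z `^ p = 2 / rate `^ p.
Proof.
apply: (@mulIf _ (rate `^ p)); first by rewrite gt_eqF ?powR_gt0.
rewrite divfK ?gt_eqF ?powR_gt0//.
rewrite -powRM ?ltW// /z -mulrA /rate -!powRD; try by apply/implyP;
  rewrite pnatr_eq0.
rewrite -powRrM -[RHS]powRr1//; congr (2 `^ _).
by field; rewrite gt_eqF.
Qed.

(** The threshold tau = z^k balances the two terms of the bound
    x^p <= tau^p + tau^(p-2) x^2: it satisfies z^2 = 2 rate^2, which cancels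
    the allowance rate^(2k) for the squares, and z^p = 2 / rate^p, which leaves
    the gain rate^(-k p). *)
Lemma level_power_sum (m h k : nat) (x : nat -> R) (C : R) : 0 <= C -> (h +
  k)%N = m ->
  \sum_(c < 2 ^ h) x c ^+ 2 <= C * (2 ^ m)%:R * (rate ^+ 2) ^+ k ->
  9 * \sum_(c < 2 ^ h) `|x c| `^ p <=
    (9 * (1 + C) * (2 ^ m)%:R `^ p^-1 / rate ^+ k) `^ p.
Proof.
move=> C0 hkm Q; have /andP[p1 p2] := p12.
pose tau := z ^+ k.
have tau0 : 0 < tau by rewrite exprn_gt0.
have taup : tau `^ p = 2 ^+ k / (rate `^ p) ^+ k.
  rewrite /tau -expr_div_n -zp -powR_mulrn ?ltW// -powRrM mulrC powRrM.
  by rewrite powR_mulrn// powR_ge0.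
have tau2 : tau ^+ 2 = 2 ^+ k * (rate ^+ 2) ^+ k.
  by rewrite /tau exprAC z2 exprMn.
have r2k : 0 < (rate ^+ 2) ^+ k by rewrite !exprn_gt0.
have rpk : 0 < (rate `^ p) ^+ k by rewrite exprn_gt0// powR_gt0.
have e2k : 0 < (2 : R) ^+ k by rewrite exprn_gt0.
have em : ((2 ^ m)%:R : R) = (2 ^ h)%:R * 2 ^+ k.
  by rewrite -hkm !natrX exprD.
have key : \sum_(c < 2 ^ h) `|x c| `^ p <= (1 + C) * (2 ^ m)%:R / (rate `^ p)
  ^+ k.
  apply: (@le_trans _ _ (\sum_(c < 2 ^ h) (tau `^ p + tau `^ p / tau ^+ 2 * x c
    ^+ 2))).
    apply: ler_sum => c _; rewrite -(real_normK (num_real (x c))).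
    by apply: powR_threshold => //; apply: ltW.
  rewrite big_split/= -mulr_sumr sumr_const card_ord.
  apply: (@le_trans _ _ (tau `^ p *+ 2 ^ h +
      tau `^ p / tau ^+ 2 * (C * (2 ^ m)%:R * (rate ^+ 2) ^+ k))).
    by rewrite lerD2l ler_wpM2l// divr_ge0 ?powR_ge0// exprn_ge0// ltW.
  rewrite -[_ *+ 2 ^ h]mulr_natl tau2 taup em; apply: eq_ler.
  by field; rewrite !gt_eqF.
apply: (@le_trans _ _ (9 * ((1 + C) * (2 ^ m)%:R / (rate `^ p) ^+ k))).
  by rewrite ler_wpM2l.
have T0 : 0 <= (2 ^ m)%:R `^ p^-1 :> R by exact: powR_ge0.
(* A constant that is at least 1 is at most its own p-th power. *)
have c1 : 1 <= 9 * (1 + C) by lra.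
have rk0 : 0 < rate ^+ k by rewrite exprn_gt0.
rewrite powRM ?invr_ge0 ?(ltW rk0)//; last by rewrite mulr_ge0//; lra.
rewrite powRM//; last by lra.
rewrite -powRrM mulVf ?gt_eqF// powRr1//.
have -> : (rate ^+ k)^-1 `^ p = ((rate `^ p) ^+ k)^-1.
  rewrite -powR_inv1 ?(ltW rk0)// -powRrM mulrC powRrM powR_inv1 ?powR_ge0//.
  congr (_^-1); rewrite -powR_mulrn ?(ltW rate_gt0)// -powRrM mulrC powRrM.
  by rewrite powR_mulrn// powR_ge0.
rewrite !mulrA ler_pM2r ?invr_gt0// ler_pM2r ?ltr0n ?expn_gt0//.
by apply: le1r_powR.
Qed.

Lemma powR_le_add_sqr (x : R) : 0 <= x -> x `^ p <= x + x ^+ 2.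
Proof.
move=> x0; have /andP[p1 p2] := p12; have [x1|x1] := leP x 1.
  have [->|xn0] := eqVneq x 0; first by rewrite powR0 ?gt_eqF// expr0n addr0.
  rewrite (@le_trans _ _ x)//; last by rewrite lerDl sqr_ge0.
  by rewrite ge1r_powR// lt_neqAle eq_sym xn0 x0.
rewrite (@le_trans _ _ (x ^+ 2))//; last by rewrite lerDr.
by rewrite -powR_mulrn//; apply: ler_powR; lra.
Qed.

Lemma geometric_sum_le m : \sum_(k < m) rate^-1 ^+ k <= (1 - rate^-1)^-1.
Proof.
have r1 : 0 < 1 - rate^-1.
  by rewrite subr_gt0 invf_lt1// rate_gt1.
have -> : \sum_(k < m) rate^-1 ^+ k = (1 - rate^-1 ^+ m) / (1 - rate^-1).
  apply: (@mulIf _ (1 - rate^-1)); first by rewrite gt_eqF.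
  rewrite divfK ?gt_eqF//; elim: m => [|m IH].
    by rewrite big_ord0 mul0r expr0 subrr.
  by rewrite big_ord_recr/= mulrDl IH exprSr; ring.
rewrite ler_pdivrMr// mulVf ?gt_eqF// lerBlDr lerDl exprn_ge0//.
by rewrite invr_ge0 ltW.
Qed.

Lemma rate_geometric m :
  \sum_(h < m) (rate ^+ (m - h.+1))^-1 <= (1 - rate^-1)^-1.
Proof.
apply: le_trans (geometric_sum_le m); rewrite (reindex_inj rev_ord_inj)/=.
apply: ler_sum => k _; rewrite subnSK// subKn; last exact: ltnW.
by rewrite exprVn.
Qed.

End Rate.

Section Chaining.
Variables (R : realType) (p B : R) (F : R -> R).
Hypothesis p12 : 1 <= p < 2.
Hypothesis B_gt0 : 0 < B.
Hypothesis F_mono : forall s t, 0 <= s -> s <= t -> F s <= F t.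
Hypothesis F_le : forall t, 0 <= t -> 0 <= F t <= B.
Variables (m n : nat) (Ms : R -> R) (C : R).
Hypothesis C_ge0 : 0 <= C.
Hypothesis n_le : (n <= 2 ^ m.+1)%N.
Hypothesis Ms_mono : forall s t, 0 <= s -> s <= t -> Ms s <= Ms t.
Let S t := Ms t - n%:R * F t.
Let T : R := (2 ^ m)%:R `^ p^-1.

Definition bottom_const : R := 9 * (1 + 64 * (B + 1) ^+ 2 + 4 * C).
Definition chain_const : R :=
  1 + bottom_const + 9 * (1 + C) * (1 - (rate p)^-1)^-1.

Let T_gt0 : 0 < T. Proof. by rewrite powR_gt0// ltr0n expn_gt0. Qed.
Let p_gt0 : 0 < p. Proof. by move: p12 => /andP[]; lra. Qed.

Lemma bottom_const_ge1 : 1 <= bottom_const.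
Proof. by rewrite /bottom_const; have := sqr_ge0 (B + 1); have := C_ge0; lra. Qed.

(** The difference of two successive approximations of S is constant on each
    cell, where it is, up to sign, the increment of S over the link of that cell. *)
Lemma level_pvar h : (h < m)%N ->
  \sum_(c < 2 ^ h.+1) (S (link_max F B h c) - S (link_min F B h c)) ^+ 2
    <= C * (2 ^ m)%:R * (rate p ^+ 2) ^+ (m - h.+1) ->
  pvar_bound p (fun t => S (nearby F B h.+1 t) - S (nearby F B h t))
    (9 * (1 + C) * T / rate p ^+ (m - h.+1)).
Proof.
move=> hm Q k t t0 tS; have tj := partition_ge0 t0 tS.
pose x c := S (link_max F B h c) - S (link_min F B h c).
apply: le_trans (level_power_sum p12 (x := x) C_ge0 (subnKC hm) Q).
pose D j := S (nearby F B h.+1 (t j)) - S (nearby F B h (t j)).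
apply: (@cell_variation_bound _ p (2 ^ h.+1) (fun c => `|x c| `^ p) k
   (fun j => cell F B h.+1 (t j)) D (fun=> 0)) => //.
- by move=> j jk; apply: cell_mono => //; [exact/tj/ltnW|exact/ltW/tS].
- by move=> j jk; apply: cell_lt => //; exact: tj.
- by move=> j jk; rewrite lexx powR_ge0.
- by move=> j jk; rewrite /D link_dist//; exact: tj.
- move=> j jk e; have jk' := ltnW jk;
  have e' : cell F B h (t j) = cell F B h (t j.+1).
    by rewrite !(cell_half (F := F) (B := B) _ _ h) ?tj// e.
  by rewrite /D /nearby e e' subrr normr0 powR0 ?gt_eqF// addr0.
Qed.

Variables l u : nat -> nat -> R.
Hypothesis lu_bounds : forall c k, 0 <= l c k <= u c k.
Hypothesis lu_F : forall c k, F (u c k) - F (l c k) <= (B + 1) / (2 ^ m)%:R.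
Hypothesis lu_nested : forall c i j, (i <= j)%N -> l c j <= l c i /\ u c i <= u
  c j.
Hypothesis lu_rep : forall t, 0 <= t ->
  l (cell F B m t) 0%N <= nearby F B m t <= u (cell F B m t) 0%N.
Hypothesis lu_cover : forall t, 0 <= t -> exists k, l (cell F B m t) k <= t <=
  u (cell F B m t) k.

(** Inside a finest cell S moves at most as much as the monotone function
    Ms + n F, so its steps add up to at most V c.  On a finest cell n F varies
    by at most a constant, so V is of order 1 on average and little is lost by
    bounding V^p with V + V^2.  The quantity psi j = a j + (a j)^2, where a j is
    the part of V c already spent at time t j, is a potential for the steps
    inside a cell. *)
Lemma bottom_pvar :
  (forall k, \sum_(c < 2 ^ m) (S (u c k) - S (l c k)) ^+ 2 <= C * (2 ^ m)%:R) ->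
  pvar_bound p (fun t => S t - S (nearby F B m t)) (bottom_const * T).
Proof.
move=> Q r t t0 tS; have tj := partition_ge0 t0 tS.
pose kap j := cell F B m (t j).
(* A partition has finitely many times, so one index K serves for all. *)
have [K tK] : exists K, forall j, (j <= r)%N -> l (kap j) K <= t j <= u (kap j) K.
  have : forall r', (r' <= r)%N ->
      exists K, forall j, (j <= r')%N -> l (kap j) K <= t j <= u (kap j) K.
    elim=> [|r' IH] r'r.
      by have [K HK] := lu_cover t0; exists K => j; rewrite leqn0 => /eqP ->.
    have [K1 HK1] := IH (ltnW r'r); have [K2 HK2] := lu_cover (tj _ r'r).
    exists (K1 + K2)%N => j; rewrite leq_eqVlt => /predU1P[->|jr'].
      have [h1 h2] := lu_nested (kap r'.+1) (leq_addl K1 K2).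
      by have /andP[h3 h4] := HK2; rewrite (le_trans h1 h3) (le_trans h4 h2).
    have [h1 h2] := lu_nested (kap j) (leq_addr K2 K1).
    by have /andP[h3 h4] := HK1 j jr'; rewrite (le_trans h1 h3) (le_trans h4 h2).
  by move=> /(_ r (leqnn r)).
pose A s := Ms s + n%:R * F s.
have A_mono s s' : 0 <= s -> s <= s' -> A s <= A s'.
  by move=> s0 ss'; rewrite lerD ?Ms_mono// ler_wpM2l// F_mono.
have SA s s' : 0 <= s -> s <= s' -> `|S s' - S s| <= A s' - A s.
  move=> s0 ss'; have := Ms_mono s0 ss';
    have := ler_wpM2l (ler0n R n) (F_mono s0 ss').
  by rewrite /S /A ler_norml => ? ?; apply/andP; split; lra.
pose V c := A (u c K) - A (l c K).
have V0 c : 0 <= V c.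
  by have /andP[l0 lu] := lu_bounds c K; rewrite subr_ge0 A_mono.
have incV c s s' : l c K <= s <= u c K -> l c K <= s' <= u c K -> `|S s' - S s|
  <= V c.
  have /andP[l0 _] := lu_bounds c K.
  have wl a b : a <= b -> l c K <= a -> b <= u c K -> `|S b - S a| <= V c.
    move=> ab la bu; rewrite (le_trans (SA _ _ (le_trans l0 la) ab))//.
    have b0 : 0 <= b := le_trans (le_trans l0 la) ab.
    by rewrite lerB ?A_mono.
  move=> /andP[h1 h2] /andP[h3 h4]; have [ss'|/ltW ss'] := leP s s';
    first exact: wl.
  by rewrite distrC wl.
have sqmono (a b : R) : 0 <= a -> a <= b -> a + a ^+ 2 <= b + b ^+ 2 by nra.
have pV (x : R) c : `|x| <= V c -> `|x| `^ p <= V c + V c ^+ 2.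
  by move=> xV; rewrite (le_trans (powR_le_add_sqr p12 (normr_ge0 x)))// sqmono.
pose a j := A (t j) - A (l (kap j) K).
have a0 j : (j <= r)%N -> 0 <= a j <= V (kap j).
  move=> jr; have /andP[h1 h2] := tK j jr;
    have /andP[l0 _] := lu_bounds (kap j) K.
  rewrite subr_ge0 A_mono//= /V lerB// A_mono//; exact: tj.
pose D j := S (t j) - S (nearby F B m (t j)).
apply: (@le_trans _ _ (9 * \sum_(c < 2 ^ m) (V c + V c ^+ 2))).
  apply: (@cell_variation_bound _ p (2 ^ m) (fun c => V c + V c ^+ 2) r kap D
     (fun j => a j + a j ^+ 2)) => //.
  - by move=> c; rewrite addr_ge0// sqr_ge0.
  - by move=> j jr; apply: cell_mono => //; [exact/tj/ltnW|exact/ltW/tS].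
  - by move=> j jr; apply: cell_lt => //; exact: tj.
  - move=> j jr; have /andP[a1 a2] := a0 j jr.
    by rewrite addr_ge0 ?sqr_ge0//= sqmono.
  - move=> j jr; apply: (pV _ (kap j)); apply: incV; last exact: tK.
    have /andP[h1 h2] := lu_rep (tj j jr).
    have [h3 h4] := lu_nested (kap j) (leq0n K).
    by rewrite (le_trans h3 h1) (le_trans h2 h4).
  - move=> j jr e; have jr' := ltnW jr.
    have -> : D j.+1 - D j = S (t j.+1) - S (t j).
      by rewrite /D /nearby -/(kap j) -/(kap j.+1) e; ring.
    have tjj : t j <= t j.+1 by exact/ltW/tS.
    have := SA _ _ (tj j jr') tjj; set v := A (t j.+1) - A (t j) => Sv.
    have -> : a j.+1 = v + a j by rewrite /a -e /v; ring.
    have /andP[aj _] := a0 j jr'.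
    have v0 : 0 <= v by rewrite subr_ge0 A_mono// tj.
    have := le_trans (powR_le_add_sqr p12 (normr_ge0 _)) (sqmono _ _ (normr_ge0
      _) Sv).
    nra.
have e0 : 0 < ((2 ^ m)%:R : R) by rewrite ltr0n expn_gt0.
have VX c : V c + V c ^+ 2 <= 1 + 64 * (B + 1) ^+ 2 + 4 * (S (u c K) - S (l c
  K)) ^+ 2.
  set X := S (u c K) - S (l c K).
  have VE : V c = X + 2 * (n%:R * (F (u c K) - F (l c K))).
    by rewrite /V /X /A /S; ring.
  have /andP[l0 lu] := lu_bounds c K.
  have F0 : 0 <= F (u c K) - F (l c K) by rewrite subr_ge0 F_mono.
  have nF : n%:R * (F (u c K) - F (l c K)) <= 2 * (B + 1).
    apply: (@le_trans _ _ ((2 ^ m.+1)%:R * ((B + 1) / (2 ^ m)%:R))).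
      by apply: ler_pM => //; rewrite ler_nat.
    by rewrite expnS natrM; apply: eq_ler; field; rewrite gt_eqF.
  have nF0 : 0 <= n%:R * (F (u c K) - F (l c K)) by rewrite mulr_ge0.
  move: VE (V0 c) nF nF0; set w := n%:R * _; move: (V c) => v -> v0 nF nF0.
  have := sqr_ge0 (X - 2 * w); have := sqr_ge0 (X + 2 * w - 1); nra.
apply: (@le_trans _ _ (bottom_const * (2 ^ m)%:R)).
  rewrite /bottom_const -mulrA ler_wpM2l//.
  apply: (@le_trans _ _ (\sum_(c < 2 ^ m) (1 + 64 * (B + 1) ^+ 2 +
      4 * (S (u c K) - S (l c K)) ^+ 2))); first by apply: ler_sum => c _;
        exact: VX.
  rewrite big_split/= sumr_const card_ord -mulr_sumr -[_ *+ 2 ^ m]mulr_natr.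
  by rewrite [leRHS]mulrDl lerD2l -[leRHS]mulrA ler_wpM2l.
have bc := bottom_const_ge1.
rewrite powRM ?(ltW T_gt0)//; last by rewrite (le_trans _ bc).
rewrite /T -powRrM mulVf ?gt_eqF// powRr1// ler_pM2r//.
by apply: le1r_powR => //; move: p12 => /andP[].
Qed.

(** S is the sum of its constant approximation of level 0, of the differences
    of successive approximations and of the rest below level m.  By Minkowski's
    inequality their bounds add up, to a geometric series led by the finest
    level. *)
Lemma chaining_pvar :
  (forall h, (h < m)%N ->
    \sum_(c < 2 ^ h.+1) (S (link_max F B h c) - S (link_min F B h c)) ^+ 2
    <= C * (2 ^ m)%:R * (rate p ^+ 2) ^+ (m - h.+1)) ->
  (forall k, \sum_(c < 2 ^ m) (S (u c k) - S (l c k)) ^+ 2 <= C * (2 ^ m)%:R) ->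
  pvar_bound p S (chain_const * T).
Proof.
move=> Qlev Qbot; have /andP[p1 p2] := p12.
have bc := lt_le_trans ltr01 bottom_const_ge1; have C0 := C_ge0.
have rg : 0 < rate p := lt_trans ltr01 (rate_gt1 p12).
have h0 : pvar_bound p (fun t => S (nearby F B 0 t)) T.
  apply: pvar_bound_cst => // t t0; congr S; rewrite /nearby; congr cell_rep.
  have := cell_lt B_gt0 F_le 0 t0; have := cell_lt B_gt0 F_le 0 (lexx 0).
  by rewrite expn0 !ltnS !leqn0 => /eqP -> /eqP ->.
have h1 := pvar_boundD p1 T_gt0 (mulr_gt0 bc T_gt0) h0 (bottom_pvar Qbot).
have Tb : 0 < T + bottom_const * T by rewrite addr_gt0// mulr_gt0.
pose f h t := S (nearby F B h.+1 t) - S (nearby F B h t).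
pose a h := 9 * (1 + C) * T / rate p ^+ (m - h.+1).
have h2 h : (h < m)%N -> 0 < a h /\ pvar_bound p (f h) (a h).
  move=> hm; split; last exact/level_pvar/Qlev.
  by rewrite /a divr_gt0 ?exprn_gt0// !mulr_gt0//; lra.
have := pvar_bound_sum p1 Tb h2 h1.
move=> H k t t0 tS; apply: (@le_trans _ _ ((T + bottom_const * T + \sum_(h < m)
  a h) `^ p)).
  apply: pvar_bound_eq H k t t0 tS => t _.
  rewrite -(big_mkord xpredT (fun h => f h t)) telescope_sumr//.
  by rewrite /=; ring.
have a0 : 0 <= \sum_(h < m) a h.
  by apply: sumr_ge0 => -[h hm] _; have [/ltW] := h2 h hm.
have le : T + bottom_const * T + \sum_(h < m) a h <= chain_const * T.
  rewrite /chain_const mulrDl [X in _ <= X + _]mulrDl mul1r lerD2l /a -mulr_sumr.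
  rewrite [leRHS]mulrAC ler_wpM2l ?rate_geometric//.
  by rewrite mulr_ge0 ?(ltW T_gt0)// mulr_ge0//; lra.
apply: ge0_ler_powR => //; rewrite ?nnegrE; lra.
Qed.
End Chaining.

(** * Reduction of finitely many times to a finite product space *)

Section PathEvents.
Variable R : realType.
Local Notation path_type := (g_sigma_algebraType
  [set C | exists s (A : set R), [/\ (0 <= s)%E, measurable A &
                 C = [set f : \bar R -> R | A (f s)]]]).

Lemma path_event_eval (s : \bar R) (A : set R) : (0 <= s)%E -> measurable A ->
  path_events R [set f | A (f s)].
Proof. by move=> s0 mA; apply: sub_gen_smallest; exists s, A. Qed.

Lemma path_event_forall (I : finType) (A : I -> set (\bar R -> R)) :
  (forall i, path_events R (A i)) -> path_events R [set f | forall i, A i f].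
Proof.
move=> pA; have -> : [set f | forall i, A i f] = \bigcap_(i in [set: I]) A i.
  by apply/seteqP; split=> f H i; [move=> _|]; exact: H.
exact: (@fin_bigcap_measurable _ path_type I setT A finite_finset (fun i _ =>
  pA i)).
Qed.

Lemma path_eventI (A A' : set (\bar R -> R)) :
  path_events R A -> path_events R A' -> path_events R (A `&` A').
Proof. exact: (@measurableI _ path_type). Qed.

Lemma path_eventT : path_events R setT.
Proof. exact: (@measurableT _ path_type). Qed.

Lemma path_event_measurable d (T : measurableType d) (N : \bar R -> T -> R) A :
  counting_process N -> path_events R A -> measurable (path_of N @^-1` A).
Proof.
move=> cN; apply: (smallest_sub (X := [set A | measurable (path_of N @^-1` A)])).
  split => /=.
  - by rewrite preimage_set0.
  - by move=> C mC; rewrite setTD -preimage_setC; exact: measurableC.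
  - by move=> C mC; rewrite preimage_bigcup; exact: bigcup_measurable.
move=> C [s [D [s0 mD ->]]] /=.
have := counting_measurable cN s0; move=> /(_ measurableT _ mD).
by rewrite setTI.
Qed.

End PathEvents.

Section StateModel.
Variables (R : realType) (B : R) (L : nat) (a b : nat -> R).
Hypothesis a_ge0 : forall c, 0 <= a c.
Hypothesis b_ge0 : forall c, 0 <= b c.

(** What a path does at the finitely many times a c and b c: its values there
    are integers between 0 and B, so there are finitely many possibilities. *)
Definition state : finType := {ffun 'I_L -> 'I_(Num.truncn B).+1 *
  'I_(Num.truncn B).+1}.
Definition state_event (y : state) : set (\bar R -> R) :=
  [set f | forall c : 'I_L, f (a c)%:E = (y c).1%:R /\ f (b c)%:E = (y c).2%:R].

Lemma path_event_state y : path_events R (state_event y).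
Proof.
apply: (@path_event_forall R 'I_L (fun c => [set f : \bar R -> R |
   f (a c)%:E = (y c).1%:R /\ f (b c)%:E = (y c).2%:R]) _) => c.
apply: path_eventI.
  by apply: (@path_event_eval _ _ [set (y c).1%:R]) => //; rewrite lee_fin.
by apply: (@path_event_eval _ _ [set (y c).2%:R]) => //; rewrite lee_fin.
Qed.

Lemma state_event_inj y y' f : state_event y f -> state_event y' f -> y = y'.
Proof.
move=> H H'; apply/ffunP => c; have [h1 h2] := H c; have [h1' h2'] := H' c.
have e (i j : 'I_(Num.truncn B).+1) : (i%:R : R) = j%:R -> i = j.
  by move=> /eqP; rewrite eqr_nat => /eqP/val_inj.
by rewrite (surjective_pairing (y c)) (surjective_pairing (y' c));
  congr pair; apply: e; rewrite -?h1 -?h2.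
Qed.

Lemma state_exists d (T : measurableType d) (N : \bar R -> T -> R) w :
  counting_process N -> N +oo%E w <= B -> exists y, state_event y (path_of N w).
Proof.
move=> cN NB.
have val (s : R) : 0 <= s -> exists i : 'I_(Num.truncn B).+1, N s%:E w = i%:R.
  move=> s0; have s0' : (0 <= s%:E)%E by rewrite lee_fin.
  have /natrP[k kE] := counting_nat cN w s0'.
  have kB : (k < (Num.truncn B).+1)%N.
    rewrite ltnS truncn_ge_nat; last first.
      by rewrite (le_trans _ NB)// -(counting0 cN w) (counting_incr cN)// leey.
    by rewrite -kE (le_trans _ NB)// (counting_incr cN)// leey.
  by exists (Ordinal kB).
have /choice[y yP] : forall c : 'I_L, exists ij : 'I_(Num.truncn B).+1 *
  'I_(Num.truncn B).+1,
    N (a c)%:E w = ij.1%:R /\ N (b c)%:E w = ij.2%:R.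
  by move=> c; have [i iE] := val _ (a_ge0 c); have [j jE] := val _ (b_ge0 c);
    exists (i, j).
by exists [ffun c => y c] => c; rewrite ffunE; exact: yP.
Qed.

Section Law.
Context d0 (T0 : measurableType d0) (P0 : probability T0 R) (N : \bar R -> T0
  -> R).
Hypothesis cN : counting_process N.
Hypothesis NB : {ae P0, forall w, N +oo%E w <= B}.

Definition state_mass (y : state) : R := fine (P0 (path_of N @^-1` state_event
  y)).

Let mE y : measurable (path_of N @^-1` state_event y).
Proof. exact: (path_event_measurable cN (path_event_state y)). Qed.

Lemma state_massE y : (state_mass y)%:E = P0 (path_of N @^-1` state_event y).
Proof. by rewrite fineK// fin_num_measure. Qed.

Lemma state_mass_ge0 y : 0 <= state_mass y.
Proof. by rewrite -lee_fin state_massE. Qed.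

Lemma state_mean (phi : state -> R) (X : T0 -> R) : measurable_fun setT X ->
  (forall y, 0 <= phi y) -> (forall w, 0 <= X w) ->
  (forall w y, state_event y (path_of N w) -> X w = phi y) ->
  (\int[P0]_w (X w)%:E)%E = (\sum_y state_mass y * phi y)%:E.
Proof.
move=> mX phi0 X0 Xphi.
pose g (y : state) (w : T0) : \bar R := (phi y * \1_(path_of N @^-1`
  state_event y) w)%:E.
have mg y : measurable_fun setT (g y).
  by apply/measurable_EFinP; apply: measurable_funM => //;
    exact: measurable_indic.
have g0 y w : (0 <= g y w)%E by rewrite lee_fin mulr_ge0.
rewrite (ge0_ae_eq_integral (g := fun w => (\sum_y g y w)%E)) => //.
- rewrite ge0_integral_sum// -sumEFin; apply: eq_bigr => y _.
  rewrite /g (integralZl_indic _ (fun=> path_of N @^-1` state_event y))//;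
    last first.
    by move=> /(le_lt_trans (phi0 y)); rewrite ltxx.
  by rewrite integral_indic// setIT EFinM state_massE muleC.
- exact/measurable_EFinP.
- exact: emeasurable_sum.
- by move=> w _; rewrite lee_fin.
- by move=> w _; apply: sume_ge0 => y _; exact: g0.
apply: filterS NB => w wB _.
have [y yw] := state_exists cN wB.
rewrite (bigD1 y)//= big1 ?adde0; last first.
  move=> y' y'y; rewrite /g indicE memNset ?mulr0// => yw'.
  by move/eqP: y'y; apply; exact: state_event_inj yw' yw.
by rewrite /g indicE mem_set// mulr1 (Xphi _ _ yw).
Qed.

Lemma state_mass_sum1 : \sum_y state_mass y = 1.
Proof.
have := @state_mean (fun=> 1) (fun=> 1) (measurable_cst _).
under eq_bigr do rewrite mulr1.
move=> /(_ (fun=> ler01) (fun=> ler01) (fun _ _ _ => erefl)).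
rewrite (_ : \int[P0]_ _ 1 = 1%:E)%E; first by case=> <-.
by rewrite integral_cst//= mul1e; exact: probability_setT.
Qed.

Lemma mean_state (c : 'I_L) :
  mean_function P0 N (a c)%:E = \sum_y state_mass y * (y c).1%:R /\
  mean_function P0 N (b c)%:E = \sum_y state_mass y * (y c).2%:R.
Proof.
have N0 s w : 0 <= s -> 0 <= N s%:E w.
  by move=> s0; rewrite -(counting0 cN w) (counting_incr cN)// lee_fin.
have E s (phi : state -> R) : 0 <= s -> (forall y, 0 <= phi y) ->
    (forall w y, state_event y (path_of N w) -> N s%:E w = phi y) ->
    mean_function P0 N s%:E = \sum_y state_mass y * phi y.
  move=> s0 phi0 Nphi; rewrite /mean_function unlock (@state_mean phi)//.
    by apply: (counting_measurable cN); rewrite lee_fin.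
  by move=> w; exact: N0.
by split; apply: E => // w y /(_ c)[].
Qed.

(** States of positive mass are visited by actual paths, and so inherit
    pathwise inequalities such as monotonicity. *)
Lemma state_mass_realized y : state_mass y != 0 ->
  exists2 w, state_event y (path_of N w) & N +oo%E w <= B.
Proof.
apply: contra_neqP => /forall2NP H.
have neg : P0.-negligible (path_of N @^-1` state_event y).
  by apply: negligibleS NB => w yw; case: (H w).
by rewrite /state_mass (measure_negligible (mE y) neg).
Qed.

End Law.

Lemma state_product d0 (T0 : measurableType d0) (P0 : probability T0 R)
    (N : \bar R -> T0 -> R) d (T : measurableType d) (P : probability T R)
    (Ni : nat -> \bar R -> T -> R) (M : nat) (e : {ffun 'I_M -> state}) :
  counting_process N ->
  (forall i, same_distribution P0 N P (Ni i)) ->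
  independent_processes P Ni ->
  P [set w | forall i : 'I_M, state_event (e i) (path_of (Ni i) w)] =
  (prod_weight (state_mass P0 N) e)%:E.
Proof.
move=> cN sd ind.
pose A (i : nat) := if insub i is Some j then state_event (e j) else setT.
have AE (i : 'I_M) : A i = state_event (e i) by rewrite /A valK.
have pA i : path_events R (A i).
  by rewrite /A; case: insub => [j|];
    [exact: path_event_state|exact: path_eventT].
have := ind (iota 0 M) A (iota_uniq 0 M) pA.
have -> : \bigcap_(i in [set` iota 0 M]) path_of (Ni i) @^-1` A i =
    [set w | forall i : 'I_M, state_event (e i) (path_of (Ni i) w)].
  apply/seteqP; split=> w H i.
    by have := H i; rewrite /= mem_iota ltn_ord AE => /(_ isT).
  by rewrite /= mem_iota => /andP[_ iM]; have := H (Ordinal iM); rewrite -AE.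
move=> ->; have -> : iota 0 M = index_iota 0 M by rewrite /index_iota subn0.
rewrite big_mkord -prodEFin; apply: eq_bigr => i _.
rewrite AE state_massE//; apply: sd; exact: path_event_state.
Qed.

End StateModel.

(** * Square sums of the deviation at one level *)

Lemma measure_bigsetU_le d (T : measurableType d) (R : realType)
    (P : {measure set T -> \bar R}) (I : Type) (r : seq I) (p : pred I) (A : I
      -> set T) :
  (forall i, measurable (A i)) ->
  (P (\big[setU/set0]_(i <- r | p i) A i) <= \sum_(i <- r | p i) P (A i))%E.
Proof.
move=> mA; elim: r => [|i r IH]; first by rewrite !big_nil measure0.
rewrite !big_cons; case: ifP => // _.
apply: le_trans (leeD2l _ IH); apply: measureU2 => //.
exact: bigsetU_measurable.
Qed.

Section LevelEvent.
Variables (R : realType) (B : R).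
Context d0 (T0 : measurableType d0) (P0 : probability T0 R) (N : \bar R -> T0
  -> R).
Hypothesis cN : counting_process N.
Hypothesis NB : {ae P0, forall w, N +oo%E w <= B}.
Let F t := mean_function P0 N t%:E.

Lemma counting_bounds d (T : measurableType d) (N' : \bar R -> T -> R) w t :
  counting_process N' -> N' +oo%E w <= B -> 0 <= t -> 0 <= N' t%:E w <= B.
Proof.
move=> cN' N'B t0; rewrite -{1}(counting0 cN' w) (counting_incr cN')//=.
by rewrite (le_trans _ N'B)// (counting_incr cN')// ?lee_fin// leey.
Qed.

Lemma counting_mono d (T : measurableType d) (N' : \bar R -> T -> R) w s t :
  counting_process N' -> 0 <= s -> s <= t -> N' s%:E w <= N' t%:E w.
Proof. by move=> cN' s0 st; rewrite (counting_incr cN')// lee_fin. Qed.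

Lemma mean_mono s t : 0 <= s -> s <= t -> F s <= F t.
Proof.
move=> s0 st; have t0 := le_trans s0 st.
rewrite /F; have [-> ->] := mean_state (L := 1) (fun=> s0) (fun=> t0) cN NB ord0.
apply: ler_sum => y _.
have [->|y0] := eqVneq (state_mass (fun=> s) (fun=> t) P0 N y) 0.
  by rewrite !mul0r.
rewrite ler_wpM2l ?state_mass_ge0//.
have [w /(_ ord0)[<- <-] _] := state_mass_realized (fun=> s0) (fun=> t0) cN NB y0.
exact: counting_mono.
Qed.

Lemma mean_range t : 0 <= t -> 0 <= F t <= B.
Proof.
move=> t0; rewrite /F;
  have [_ ->] := mean_state (L := 1) (fun=> t0) (fun=> t0) cN NB ord0.
rewrite sumr_ge0/=; last first.
  by move=> y _; rewrite mulr_ge0// state_mass_ge0.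
have m1 := @state_mass_sum1 R B 1 _ _ (fun=> t0) (fun=> t0) _ _ P0 N cN NB.
apply: (@le_trans _ _ (\sum_(y : state B 1) state_mass (fun=> t) (fun=> t) P0 N
  y * B)); last first.
  by rewrite -mulr_suml m1 mul1r.
apply: ler_sum => y _.
have [->|y0] := eqVneq (state_mass (fun=> t) (fun=> t) P0 N y) 0;
  first by rewrite !mul0r.
rewrite ler_wpM2l ?state_mass_ge0//.
have [w /(_ ord0)[_ <-] wB] := state_mass_realized (fun=> t0) (fun=> t0) cN NB y0.
by have /andP[] := counting_bounds cN wB t0.
Qed.

Lemma sqr_sum_pairs (x : nat -> R) n : (\sum_(i < n) x i) ^+ 2 =
  \sum_(i < n) x i ^+ 2 + 2 * \sum_(i < n) \sum_(j < i) x j * x i.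
Proof.
elim: n => [|n IH]; first by rewrite !big_ord0 expr0n/= mulr0 addr0.
by rewrite !big_ord_recr/= sqrrD IH -mulr_suml; ring.
Qed.

Lemma sum_sqr_le (n : nat) (x : nat -> R) (S : R) : (forall c, 0 <= x c) ->
  \sum_(c < n) x c <= S -> \sum_(c < n) x c ^+ 2 <= S ^+ 2.
Proof.
move=> x0 xS; apply: (@le_trans _ _ (\sum_(c < n) x c * S)).
  apply: ler_sum => c _; rewrite expr2 ler_wpM2l// (le_trans _ xS)//.
  by rewrite (bigD1 c)//= lerDl sumr_ge0.
have S0 : 0 <= S by apply: le_trans xS; exact: sumr_ge0.
by rewrite -mulr_suml expr2 ler_wpM2r.
Qed.

Context d (T : measurableType d) (P : probability T R) (Ni : nat -> \bar R -> T
  -> R).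
Hypothesis cNi : forall i, counting_process (Ni i).
Hypothesis sd : forall i, same_distribution P0 N P (Ni i).
Hypothesis ind : independent_processes P Ni.

Definition count_sum (n : nat) (w : T) (t : R) : R := \sum_(i < n) Ni i t%:E w.
Definition deviation (n : nat) (w : T) (t : R) : R := count_sum n w t - n%:R *
  F t.

(** The sum of squares splits into a diagonal part, which is bounded surely
    because each single process has total increment at most S, and twice a
    degenerate U-statistic, whose maximum over n <= 2^q exceeds tau only on a
    small event A. *)
Lemma level_event (L q : nat) (a b : nat -> R) (S phi tau : R) :
  (forall c, 0 <= a c <= b c) ->
  (forall f : R -> R, (forall s t, 0 <= s -> s <= t -> f s <= f t) ->
    (forall t, 0 <= t -> 0 <= f t <= B) -> \sum_(c < L) (f (b c) - f (a c)) <=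
      S) ->
  (forall c, F (b c) - F (a c) <= phi) -> 0 <= phi -> 0 < tau ->
  exists A, [/\ measurable A,
    (P A <= (q.+1%:R ^+ 2 * (2 ^ q)%:R ^+ 2 * (16 * S ^+ 3 * phi) / tau ^+
      2)%:E)%E &
    forall w, (forall i, Ni i +oo%E w <= B) -> ~ A w -> forall n, (n <= 2 ^
      q)%N ->
      \sum_(c < L) (deviation n w (b c) - deviation n w (a c)) ^+ 2
        <= n%:R * (2 * S) ^+ 2 + 2 * tau].
Proof.
move=> ab sumS Fphi phi0 tau0.
have a0 c : 0 <= a c by have /andP[] := ab c.
have ab' c : a c <= b c by have /andP[] := ab c.
have b0 c : 0 <= b c := le_trans (a0 c) (ab' c).
pose E := state B L; pose mu : E -> R := state_mass a b P0 N.
pose M := (2 ^ q)%N.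
pose Y (c : 'I_L) (y : E) : R := (y c).2%:R - (y c).1%:R.
have mu0 (y : E) : 0 <= mu y by exact: state_mass_ge0.
have mu1 : \sum_y mu y = 1 by exact: state_mass_sum1.
have YF c : \sum_y mu y * Y c y = F (b c) - F (a c).
  have [ea eb] := mean_state a0 b0 cN NB c; rewrite /F ea eb -sumrB.
  by apply: eq_bigr => y _; rewrite -mulrBr.
pose X c y := Y c y - \sum_z mu z * Y c z.
have Xc c : \sum_y mu y * X c y = 0.
  under eq_bigr do rewrite mulrBr.
  by rewrite sumrB -mulr_suml mu1 mul1r subrr.
have gamX : \sum_y mu y * (\sum_z mu z * gram X y z ^+ 2) <= 16 * S ^+ 3 * phi.
  apply: centered_gram_sqr => //.
  - move=> c y y0; have [w /(_ c)[ea eb] _] := state_mass_realized a0 b0 cN NB y0.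
    by rewrite /Y -ea -eb subr_ge0; exact: counting_mono.
  - move=> y y0; have [w yw wB] := state_mass_realized a0 b0 cN NB y0.
    have := sumS (fun t => N t%:E w); rewrite (eq_bigr (fun c => Y c y));
      last first.
      by move=> c _; have [ea eb] := yw c; rewrite /Y -ea -eb.
    by apply=> [s t|t]; [exact: counting_mono|exact: counting_bounds].
  - by move=> c; rewrite YF.
pose bad (e : {ffun 'I_M -> E}) := [exists n : 'I_(2 ^ q).+1, tau < `|ustat X e
  n|].
pose cyl (e : {ffun 'I_M -> E}) :=
  [set w | forall i : 'I_M, state_event a b (e i) (path_of (Ni i) w)].
have mcyl e : measurable (cyl e).
  have -> : cyl e = \bigcap_(i in [set: 'I_M]) path_of (Ni i) @^-1` state_event
    a b (e i).
    by apply/seteqP; split=> w H i; [move=> _|]; exact: H.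
  apply: fin_bigcap_measurable; first exact: finite_finset.
  by move=> i _; exact: (path_event_measurable (cNi i) (path_event_state a0 b0
    (e i))).
exists (\big[setU/set0]_(e | bad e) cyl e); split.
- by apply: bigsetU_measurable => e _.
- apply: (@le_trans _ _ (\sum_(e | bad e) P (cyl e))%E).
    exact: measure_bigsetU_le.
  rewrite (eq_bigr (fun e => (prod_weight mu e)%:E)); last first.
    by move=> e _; exact: state_product.
  by rewrite sumEFin lee_fin; exact: ustat_max_tail.
move=> w wB nA n nM.
have /choice[e0 e0P] : forall i : 'I_M, exists y : E, state_event a b y
  (path_of (Ni i) w).
  by move=> i; exact: state_exists.
pose e := [ffun i => e0 i].
have eP (i : 'I_M) : state_event a b (e i) (path_of (Ni i) w) by rewrite ffunE.
have nbad : ~~ bad e.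
  apply/negP => be; apply: nA; rewrite (bigD1 e)//=; left; exact: eP.
pose x (c i : nat) := Ni i (b c)%:E w - Ni i (a c)%:E w - (F (b c) - F (a c)).
have devE c : deviation n w (b c) - deviation n w (a c) = \sum_(i < n) x c i.
  rewrite /deviation /count_sum /x !sumrB !sumr_const !card_ord.
  by rewrite !mulr_natl; ring.
have xE (c : 'I_L) (i : 'I_M) : X c (e i) = x c i.
  by rewrite /X YF /Y; have [<- <-] := eP i c.
have ustatE : ustat X e n = \sum_(i < n) \sum_(j < i) \sum_(c < L) x c j * x c i.
  rewrite (big_ord_widen M (fun i => \sum_(j < i) \sum_(c < L) x c j * x c i))//.
  apply: eq_bigr => i _.
  rewrite (big_ord_widen M (fun j => \sum_(c < L) x c j * x c i)) 1?ltnW//.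
  by apply: eq_bigr => j _; apply: eq_bigr => c _; rewrite !xE.
have ut : ustat X e n <= tau.
  rewrite (le_trans (ler_norm _))// leNgt; apply: contra nbad => h.
  by apply/existsP; exists (Ordinal (n:=(2^q).+1) (m:=n) nM).
have -> : \sum_(c < L) (deviation n w (b c) - deviation n w (a c)) ^+ 2 =
    \sum_(i < n) \sum_(c < L) x c i ^+ 2 + 2 * ustat X e n.
  rewrite (eq_bigr (fun c : 'I_L => \sum_(i < n) x c i ^+ 2 +
     2 * \sum_(i < n) \sum_(j < i) x c j * x c i)); last first.
    by move=> c _; rewrite devE sqr_sum_pairs.
  rewrite big_split/= exchange_big/= -mulr_sumr ustatE; congr (_ + 2 * _).
  by rewrite exchange_big/=; apply: eq_bigr => i _; rewrite exchange_big.
apply: lerD; last by rewrite ler_pM2l.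
rewrite (le_trans (y := \sum_(i < n) (2 * S) ^+ 2))//; last first.
  by rewrite sumr_const card_ord [leRHS]mulr_natl.
apply: ler_sum => i _.
have SN := sumS (fun t => Ni i t%:E w) (fun s t => @counting_mono _ _ _ w s t
  (cNi i))
  (fun t => @counting_bounds _ _ _ w t (cNi i) (wB i)).
have SF := sumS F mean_mono mean_range.
pose v c := (Ni i (b c)%:E w - Ni i (a c)%:E w) + (F (b c) - F (a c)).
have xv c : `|x c i| <= v c.
  have := counting_mono w (cNi i) (a0 c) (ab' c);
    have := mean_mono (a0 c) (ab' c).
  by rewrite /x /v ler_norml => ? ?; apply/andP; split; lra.
apply: (@le_trans _ _ (\sum_(c < L) v c ^+ 2)).
  apply: ler_sum => c _; rewrite -(real_normK (num_real (x c i))).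
  by rewrite ler_sqr ?nnegrE// (le_trans _ (xv c)).
apply: sum_sqr_le; first by move=> c; exact: le_trans (xv c).
by rewrite big_split/= mulr_natl mulr2n lerD.
Qed.

End LevelEvent.

(** * Dyadic blocks of sample sizes *)

Section BlockEvent.
Variables (R : realType) (p B : R).
Hypothesis p12 : 1 <= p < 2.
Hypothesis B_gt0 : 0 < B.
Context d0 (T0 : measurableType d0) (P0 : probability T0 R) (N : \bar R -> T0
  -> R).
Hypothesis cN : counting_process N.
Hypothesis NB : {ae P0, forall w, N +oo%E w <= B}.
Context d (T : measurableType d) (P : probability T R) (Ni : nat -> \bar R -> T
  -> R).
Hypothesis cNi : forall i, counting_process (Ni i).
Hypothesis sd : forall i, same_distribution P0 N P (Ni i).
Hypothesis ind : independent_processes P Ni.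
Let F t := mean_function P0 N t%:E.
Let dev := deviation P0 N Ni.

Definition tail_const : R := 1024 * B ^+ 3 * (B + 1).
Definition square_const : R := 4 * (32 * B ^+ 2 + 2) + 24 * (B + 1) ^+ 2.

Definition unbounded_event : set T := \bigcup_i [set w | B < Ni i +oo%E w].

Let exceed : set (\bar R -> R) := [set f | `]B, +oo[%classic (f +oo%E)].
Let exceed_path : path_events R exceed. Proof. exact: path_event_eval. Qed.
Let exceedE i : [set w | B < Ni i +oo%E w] = path_of (Ni i) @^-1` exceed.
Proof. by apply/seteqP; split=> w; rewrite /exceed /= in_itv/= andbT. Qed.
Let m_unbounded i : measurable [set w | B < Ni i +oo%E w].
Proof. by rewrite exceedE; exact: path_event_measurable exceed_path. Qed.

Lemma unbounded_null : measurable unbounded_event /\ P unbounded_event = 0.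
Proof.
have mU : measurable unbounded_event by exact: bigcup_measurable.
split=> //; apply/measure_negligible => //; apply: negligible_bigcup => i.
apply/negligibleP => //.
rewrite exceedE; apply: etrans (sd i exceed_path) _.
apply: measure_negligible; first exact: path_event_measurable exceed_path.
by apply: negligibleS NB => w;
  rewrite /exceed /= in_itv/= andbT => Bw /(lt_le_trans Bw); rewrite ltxx.
Qed.

Lemma bounded_off w : ~ unbounded_event w -> forall i, Ni i +oo%E w <= B.
Proof. by move=> nU i; rewrite leNgt; apply/negP => Bw; apply: nU; exists i. Qed.

Let r_gt0 : 0 < rate p := lt_trans ltr01 (rate_gt1 p12).

Lemma tail_const_gt0 : 0 < tail_const.
Proof.
apply: mulr_gt0; last by rewrite addr_gt0.
by apply: mulr_gt0; [rewrite ltr0n|exact: exprn_gt0].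
Qed.

(** As rate^4 <= 2, the gain 2^-h of fine levels is at least as good as
    rate^(-4h), and the allowance at level h contributes rate^(-4k) with
    h + k close to m: every level has the same bound, exponentially small in
    m up to the factor (m + 2)^2. *)
Lemma tail_bound_le (m h k : nat) : (h <= m)%N -> (m <= h + k.+1)%N ->
  m.+2%:R ^+ 2 * (2 ^ m.+1)%:R ^+ 2 * (16 * (2 * B) ^+ 3 * ((B + 1) / (2 ^ h)%:R))
    / ((2 ^ m)%:R * (rate p ^+ 2) ^+ k) ^+ 2
  <= tail_const * m.+2%:R ^+ 2 / (rate p ^+ 4) ^+ m.
Proof.
move=> hm mhk; set r := rate p ^+ 4.
have r0 : 0 < r by rewrite exprn_gt0.
have r1 : 1 <= r by rewrite exprn_ege1// ltW// rate_gt1.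
have r2 : r <= 2 by exact: rate4_le2.
have e0 n : 0 < ((2 ^ n)%:R : R) by rewrite ltr0n expn_gt0.
have rk : ((rate p ^+ 2) ^+ k) ^+ 2 = r ^+ k by rewrite exprAC /r -(exprM _ 2 2).
rewrite [((2 ^ m)%:R * _) ^+ 2]exprMn rk expnS natrM.
set c := (X in X <= _);
  have {c} -> : c = (tail_const / 2) * m.+2%:R ^+ 2 * (1 / ((2 ^ h)%:R * r ^+ k)).
  have := e0 m; have := e0 h; have := exprn_gt0 k r0; rewrite /c /tail_const.
  move: (2 ^ m)%:R (2 ^ h)%:R (r ^+ k) m.+2%:R => u v s y s0 v0 u0.
  by field; rewrite !gt_eqF.
have B1 : 0 < B + 1 by rewrite addr_gt0.
have t0 := tail_const_gt0.
have key : r ^+ m <= 2 * ((2 ^ h)%:R * r ^+ k).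
  apply: (@le_trans _ _ (r ^+ (h + k.+1))); first by rewrite ler_weXn2l.
  have rh : r ^+ h <= (2 ^ h)%:R by rewrite natrX lerXn2r// nnegrE ltW.
  rewrite exprD exprS mulrA [leRHS]mulrA ler_pM2r ?exprn_gt0// mulrC.
  by apply: ler_pM => //; rewrite ltW// exprn_gt0.
have : 1 / ((2 ^ h)%:R * r ^+ k) <= 2 / r ^+ m.
  rewrite ler_pdivrMr ?mulr_gt0 ?exprn_gt0// mulrAC ler_pdivlMr ?exprn_gt0//.
  by rewrite mul1r.
move=> /(ler_wpM2l (x := tail_const / 2 * m.+2%:R ^+ 2)) H.
apply: (le_trans (H _)); first by rewrite mulr_ge0 ?sqr_ge0// divr_ge0// ltW.
have := exprn_gt0 m r0; move: (r ^+ m) m.+2%:R => s y s0.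
apply: eq_ler; field.
by rewrite gt_eqF.
Qed.

Lemma tail_bound_ge0 m k : 0 <= tail_const * m.+2%:R ^+ k / (rate p ^+ 4) ^+ m.
Proof.
apply: divr_ge0; last by do 2 apply: exprn_ge0; exact: ltW.
by apply: mulr_ge0; [exact/ltW/tail_const_gt0|exact: exprn_ge0].
Qed.

Lemma level_events m h : (h < m)%N -> exists A, [/\ measurable A,
  (P A <= (tail_const * m.+2%:R ^+ 2 / (rate p ^+ 4) ^+ m)%:E)%E &
  forall w, ~ unbounded_event w -> ~ A w -> forall n, (n <= 2 ^ m.+1)%N ->
    \sum_(c < 2 ^ h.+1) (dev n w (link_max F B h c) - dev n w (link_min F B h
      c)) ^+ 2
     <= (32 * B ^+ 2 + 2) * (2 ^ m)%:R * (rate p ^+ 2) ^+ (m - h.+1)].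
Proof.
move=> hm; have e0 n : 0 < ((2 ^ n)%:R : R) by rewrite ltr0n expn_gt0.
have Fm : forall s t, 0 <= s -> s <= t -> F s <= F t by exact: mean_mono cN NB.
have Fr : forall t, 0 <= t -> 0 <= F t <= B by exact: mean_range cN NB.
have rk1 : 1 <= (rate p ^+ 2) ^+ (m - h.+1).
  by rewrite -exprM exprn_ege1// ltW// rate_gt1.
have tau0 : 0 < (2 ^ m)%:R * (rate p ^+ 2) ^+ (m - h.+1) :> R.
  by rewrite mulr_gt0// (lt_le_trans ltr01).
have phi0 : 0 <= (B + 1) / (2 ^ h)%:R by rewrite divr_ge0// addr_ge0// ltW.
have [A [mA PA HA]] := level_event cN NB cNi sd ind (L := 2 ^ h.+1) m.+1
  (link_bounds F B h) (S := 2 * B)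
  (fun f fm fr => link_increments B_gt0 Fm Fr h fm fr)
  (link_F B_gt0 Fr h) phi0 tau0.
exists A; split => //.
  by apply: le_trans PA _; rewrite lee_fin; apply: tail_bound_le;
    [exact: ltnW|lia].
move=> w /bounded_off wB nA n nm; apply: le_trans (HA w wB nA n nm) _.
have nm' : n%:R <= 2 * (2 ^ m)%:R :> R by rewrite -natrM -expnS ler_nat.
move: rk1 nm' (e0 m); set g := _ ^+ (m - h.+1); set e := (2 ^ m)%:R;
  set x := n%:R.
move=> g1 xe e_gt0; have x0 : 0 <= x by [].
have b0 := sqr_ge0 B.
have h1 : x * B ^+ 2 <= 2 * e * B ^+ 2 by rewrite ler_wpM2r.
have h2 : e * B ^+ 2 <= e * B ^+ 2 * g by rewrite ler_peMr// mulr_ge0// ltW.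
have -> : (2 * (2 * B)) ^+ 2 = 16 * B ^+ 2 by ring.
nra.
Qed.

(** The increments of the counts over the brackets grow with k, unlike those of
    the centered deviation.  Stated for counts the bad events increase with k,
    so that a bound for the probability of each passes to their union. *)
Lemma bottom_events m : exists l u : nat -> nat -> R, exists A,
 [/\ [/\ forall c k, 0 <= l c k <= u c k,
         forall c k, F (u c k) - F (l c k) <= (B + 1) / (2 ^ m)%:R,
         forall c i j, (i <= j)%N -> l c j <= l c i /\ u c i <= u c j,
         forall t, 0 <= t -> l (cell F B m t) 0%N <= nearby F B m t <= u (cell
           F B m t) 0%N &
         forall t, 0 <= t -> exists k, l (cell F B m t) k <= t <= u (cell F B m
           t) k],
     measurable A,
     (P A <= (tail_const * m.+2%:R ^+ 2 / (rate p ^+ 4) ^+ m)%:E)%E &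
     forall w, ~ A w -> forall n k, (n <= 2 ^ m.+1)%N ->
       \sum_(c < 2 ^ m) (dev n w (u c k) - dev n w (l c k)) ^+ 2
       <= square_const * (2 ^ m)%:R].
Proof.
have e0 n : 0 < ((2 ^ n)%:R : R) by rewrite ltr0n expn_gt0.
have Fm : forall s t, 0 <= s -> s <= t -> F s <= F t by exact: mean_mono cN NB.
have Fr : forall t, 0 <= t -> 0 <= F t <= B by exact: mean_range cN NB.
have [l [u [lu luF nest rep [cover incr]]]] := brackets B_gt0 Fm Fr m.
pose half : R := 2 * (32 * B ^+ 2 + 2) + 8 * (B + 1) ^+ 2.
pose incs n w k := \sum_(c < 2 ^ m) (count_sum Ni n w (u c k) - count_sum Ni n
  w (l c k)) ^+ 2.
pose Ak k := \bigcup_(n in [set n | (n <= 2 ^ m.+1)%N]) [set w | half * (2 ^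
  m)%:R < incs n w k].
have l0 c k : 0 <= l c k by have /andP[] := lu c k.
have u0 c k : 0 <= u c k by have /andP[/le_trans h /h] := lu c k.
have mcount n t : 0 <= t -> measurable_fun setT (fun w => count_sum Ni n w t).
  move=> t0; apply: measurable_sum => i.
  by apply: (counting_measurable (cNi i)); rewrite lee_fin.
have mAk k : measurable (Ak k).
  apply: bigcup_measurable => n _.
  have mi : measurable_fun setT (fun w => incs n w k).
    apply: measurable_sum => c; apply: measurable_funX.
    by apply: measurable_funB; exact: mcount.
  have -> : [set w | half * (2 ^ m)%:R < incs n w k] =
      setT `&` (fun w => incs n w k) @^-1` `]half * (2 ^ m)%:R, +oo[%classic.
    by rewrite setTI; apply/seteqP; split=> w /=; rewrite in_itv/= andbT.
  exact: mi.
have count_mono n w s t : 0 <= s -> s <= t -> count_sum Ni n w s <= count_sum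
  Ni n w t.
  by move=> s0 st; apply: ler_sum => i _; exact: counting_mono.
have incc n w c i j : (i <= j)%N ->
    0 <= count_sum Ni n w (u c i) - count_sum Ni n w (l c i) <=
    count_sum Ni n w (u c j) - count_sum Ni n w (l c j).
  move=> ij; have [h1 h2] := nest c i j ij; have /andP[_ h3] := lu c i.
  by rewrite subr_ge0 count_mono//= lerB ?count_mono.
have Ak_mono : {homo Ak : i j / (i <= j)%N >-> (i <= j)%O}.
  move=> i j ij; apply/subsetPset => w [n nm] /= h; exists n => //=.
  apply: (lt_le_trans h); apply: ler_sum => c _.
  have /andP[h1 h2] := incc n w c i j ij.
  by rewrite ler_sqr// nnegrE (le_trans h1).
have phi0 : 0 <= (B + 1) / (2 ^ m)%:R by rewrite divr_ge0// addr_ge0// ltW.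
have nF n c k : (n <= 2 ^ m.+1)%N ->
    0 <= n%:R * (F (u c k) - F (l c k)) <= 2 * (B + 1).
  move=> nm; have /andP[_ lk] := lu c k.
  have F0 : 0 <= F (u c k) - F (l c k) by rewrite subr_ge0 Fm.
  rewrite mulr_ge0//=; apply: (@le_trans _ _ ((2 ^ m.+1)%:R * ((B + 1) / (2 ^
    m)%:R))).
    by apply: ler_pM => //; rewrite ler_nat.
  by rewrite expnS natrM; apply: eq_ler; field; rewrite gt_eqF.
have sqD (x y z : R) : 0 <= y <= z -> (x + y) ^+ 2 <= 2 * x ^+ 2 + 2 * z ^+ 2.
  by move=> /andP[y0 yz]; have := sqr_ge0 (x - y); nra.
have sum_const (z : R) : \sum_(c < 2 ^ m) z = z * (2 ^ m)%:R.
  by rewrite sumr_const card_ord [RHS]mulr_natr.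
have PAk k : (P (Ak k) <= (tail_const * m.+2%:R ^+ 2 / (rate p ^+ 4) ^+ m)%:E)%E.
  have B2 f : (forall s t, 0 <= s -> s <= t -> f s <= f t) ->
     (forall t, 0 <= t -> 0 <= f t <= B) ->
     \sum_(c < 2 ^ m) (f (u c k) - f (l c k)) <= 2 * B.
    by move=> fm fr; rewrite (le_trans (incr f B k fm fr))// ler_peMl// ?ltW//;
      lra.
  have [A [mA PA HA]] := level_event cN NB cNi sd ind (L := 2 ^ m) m.+1
    (fun c => lu c k) (S := 2 * B) B2 (fun c => luF c k) phi0 (e0 m).
  have [mU PU] := unbounded_null.
  apply: (@le_trans _ _ (P (A `|` unbounded_event))).
    apply: le_measure; rewrite ?inE//; first exact: measurableU.
    move=> w [n /= nm]; rewrite ltNge => /negP h;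
      apply: contrapT => /not_orP[nA nU].
    apply: h; have /(_ w (bounded_off nU) nA n nm) := HA.
    have nm' : n%:R <= 2 * (2 ^ m)%:R :> R by rewrite -natrM -expnS ler_nat.
    have -> : (2 * (2 * B)) ^+ 2 = 16 * B ^+ 2 by ring.
    move=> {}HA; apply: (@le_trans _ _ (\sum_(c < 2 ^ m)
       (2 * (dev n w (u c k) - dev n w (l c k)) ^+ 2 + 2 * (2 * (B + 1)) ^+ 2))).
      apply: ler_sum => c _.
      have -> : count_sum Ni n w (u c k) - count_sum Ni n w (l c k) =
         (dev n w (u c k) - dev n w (l c k)) + n%:R * (F (u c k) - F (l c k)).
        by rewrite /dev /deviation -/(F _) -/(F _); ring.
      exact/sqD/nF.
    rewrite big_split/= -mulr_sumr sum_const.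
    have h2 : n%:R * (16 * B ^+ 2) <= 2 * (2 ^ m)%:R * (16 * B ^+ 2).
      by rewrite ler_wpM2r// mulr_ge0// sqr_ge0.
    rewrite /half; move: HA h2; rewrite -/dev.
    move: (\sum_(c < _) _) (2 ^ m)%:R (n%:R * _) => X e y; lra.
  apply: (@le_trans _ _ (P A + P unbounded_event)%E); first exact: measureU2.
  rewrite PU adde0 (le_trans PA)// lee_fin.
  by have := @tail_bound_le m m 0%N (leqnn m); rewrite expr0 mulr1; apply; lia.
exists l, u, (\bigcup_k Ak k); split => //.
- exact: bigcup_measurable.
- have cv := nondecreasing_cvg_mu (mu := P) mAk (bigcup_measurable (fun k _ =>
  mAk k)) Ak_mono.
  rewrite -(cvg_lim _ cv)//; apply: lime_le.
    by apply/cvg_ex; eexists; exact: cv.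
  by apply: nearW => k; exact: PAk.
move=> w nA n k nm.
have h : incs n w k <= half * (2 ^ m)%:R.
  by rewrite leNgt; apply/negP => h; apply: nA; exists k => //; exists n.
apply: (@le_trans _ _ (\sum_(c < 2 ^ m)
   (2 * (count_sum Ni n w (u c k) - count_sum Ni n w (l c k)) ^+ 2 + 2 * (2 *
     (B + 1)) ^+ 2))).
  apply: ler_sum => c _.
  have -> : (dev n w (u c k) - dev n w (l c k)) ^+ 2 =
     (- (count_sum Ni n w (u c k) - count_sum Ni n w (l c k)) + n%:R * (F (u c
       k) - F (l c k))) ^+ 2.
    by rewrite /dev /deviation -/(F _) -/(F _); ring.
  by rewrite -[X in 2 * X + _]sqrrN; exact/sqD/nF.
rewrite big_split/= -mulr_sumr sum_const /square_const.
move: h; rewrite /incs /half.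
move: (\sum_(c < _) _) (2 ^ m)%:R => X e; lra.
Qed.

Definition block_const : R := chain_const p B square_const.

Lemma square_const_ge : 32 * B ^+ 2 + 2 <= square_const.
Proof. by rewrite /square_const; have := sqr_ge0 B; have := sqr_ge0 (B + 1);
  lra. Qed.

(** One event serves all sample sizes up to 2^(m+1): the union of the bad events
    of the links of the m levels and of the brackets. *)
Lemma block_event m : exists A,
 [/\ measurable A,
     (P A <= (tail_const * m.+2%:R ^+ 3 / (rate p ^+ 4) ^+ m)%:E)%E &
     forall w, ~ unbounded_event w -> ~ A w -> forall n, (n <= 2 ^ m.+1)%N ->
       pvar_bound p (dev n w) (block_const * (2 ^ m)%:R `^ p^-1)].
Proof.
have e0 n : 0 < ((2 ^ n)%:R : R) by rewrite ltr0n expn_gt0.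
have Fm : forall s t, 0 <= s -> s <= t -> F s <= F t by exact: mean_mono cN NB.
have Fr : forall t, 0 <= t -> 0 <= F t <= B by exact: mean_range cN NB.
have [l [u [A0 [[lu luF nest rep cover] mA0 PA0 HA0]]]] := bottom_events m.
have /choice[Al AlP] : forall h, exists A, [/\ measurable A,
    (P A <= (tail_const * m.+2%:R ^+ 2 / (rate p ^+ 4) ^+ m)%:E)%E &
    (h < m)%N -> forall w, ~ unbounded_event w -> ~ A w -> forall n, (n <= 2 ^
      m.+1)%N ->
    \sum_(c < 2 ^ h.+1) (dev n w (link_max F B h c) - dev n w (link_min F B h
      c)) ^+ 2
     <= (32 * B ^+ 2 + 2) * (2 ^ m)%:R * (rate p ^+ 2) ^+ (m - h.+1)].
  move=> h; have [hm|hm] := ltnP h m.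
    by have [A [mA PA HA]] := level_events hm; exists A; split.
  exists set0; split => //; rewrite measure0 lee_fin.
  exact: tail_bound_ge0.
have mAl h : measurable (Al h) by have [] := AlP h.
exists (A0 `|` \big[setU/set0]_(h < m) Al h); split.
- by apply: measurableU => //; exact: bigsetU_measurable.
- apply: (@le_trans _ _ (P A0 + P (\big[setU/set0]_(h < m) Al h))%E).
    by apply: measureU2 => //; exact: bigsetU_measurable.
  have Pl := @measure_bigsetU_le _ _ _ P 'I_m (index_enum 'I_m) xpredT (fun h
    => Al h)
    (fun h => mAl h).
  apply: (le_trans (leeD PA0 Pl)).
  set x := tail_const * _ / _ in PA0 *.
  have Px : (\sum_(h < m) P (Al h) <= \sum_(h < m) x%:E)%E.
    by apply: lee_sum => h _; have [] := AlP h.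
  apply: (le_trans (leeD2l _ Px));
    rewrite sumEFin -EFinD lee_fin sumr_const card_ord.
  have x0 : 0 <= x by exact: tail_bound_ge0.
  rewrite -mulrS -[leLHS]mulr_natl.
  have -> : tail_const * m.+2%:R ^+ 3 / (rate p ^+ 4) ^+ m = m.+2%:R * x.
    by rewrite /x exprS; ring.
  by rewrite ler_wpM2r// ler_nat.
move=> w nU /not_orP[nA0 nAl] n nm.
have sc : 0 <= square_const.
  by apply: le_trans square_const_ge; have := sqr_ge0 B; lra.
apply: (chaining_pvar p12 B_gt0 Fm Fr sc nm _ lu luF nest rep cover).
- by move=> s t s0 st; apply: ler_sum => i _; exact: counting_mono.
- move=> h hm; have nAh : ~ Al h w.
    by move=> Aw; apply: nAl; rewrite (bigD1 (Ordinal hm))//=; left.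
  have [_ _ /(_ hm w nU nAh n nm)] := AlP h; move=> /le_trans; apply.
  rewrite ler_wpM2r ?exprn_ge0 ?(ltW r_gt0)// ler_wpM2r ?(ltW (e0 m))//.
  exact: square_const_ge.
- by move=> k; exact: HA0.
Qed.

End BlockEvent.

(** * From dyadic blocks to the almost sure rate *)

Section PvarNorm.
Variables (R : realType) (p : R).
Hypothesis p12 : 1 <= p < 2.
Let p_gt0 : 0 < p. Proof. by move: p12 => /andP[]; lra. Qed.

Lemma pvar_bound_le (f : R -> R) (A A' : R) : 0 <= A -> A <= A' ->
  pvar_bound p f A -> pvar_bound p f A'.
Proof.
move=> A0 AA' H m t t0 tS; apply: le_trans (H m t t0 tS) _.
by apply: ge0_ler_powR; rewrite ?nnegrE ?(ltW p_gt0)// (le_trans A0).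
Qed.

Lemma pvar_boundZ (f : R -> R) (c A : R) : 0 <= c -> 0 <= A ->
  pvar_bound p f A -> pvar_bound p (fun t => c * f t) (c * A).
Proof.
move=> c0 A0 H m t t0 tS; rewrite powRM//.
apply: le_trans (ler_wpM2l (powR_ge0 c p) (H m t t0 tS)); rewrite mulr_sumr.
by apply: ler_sum => j _; rewrite -mulrBr normrM powRM// (ger0_norm c0).
Qed.

(** A function that vanishes at 0 is bounded by its p-variation seminorm, as
    the partitions 0 < t show, so the seminorm controls the whole norm. *)
Lemma pvar_norm_le (f : R -> R) (A : R) : 0 <= A -> f 0 = 0 ->
  pvar_bound p f A -> (pvar_norm p f <= (2 * A)%:E)%E.
Proof.
move=> A0 f0 H; rewrite /pvar_norm mulr_natl mulr2n EFinD; apply: leeD.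
  have vA : (pvariation p f <= (A `^ p)%:E)%E.
    apply: ge_ereal_sup => _ [m [t [t0 tS ->]]].
    by rewrite lee_fin big_add1/= big_mkord; exact: H.
  have v0 : (0 <= pvariation p f)%E.
    apply: ereal_sup_ubound; exists 0%N, (fun=> 0); split => //.
    by rewrite big_geq.
  rewrite /pvar_seminorm (@le_trans _ _ ((A `^ p)%:E `^ p^-1)%E)//.
    apply: gt0_ler_poweR => //;
      rewrite ?invr_ge0 ?(ltW p_gt0)// in_itv/= ?v0 ?leey//.
    by rewrite lee_fin powR_ge0.
  by rewrite poweR_EFin -powRrM mulfV ?gt_eqF// powRr1.
apply: ge_ereal_sup => _ [t /= t0 <-]; rewrite lee_fin.
have [->|tn0] := eqVneq t 0; first by rewrite f0 normr0.
have tgt0 : 0 < t by rewrite lt_neqAle eq_sym tn0.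
have step j : (j < 1)%N -> (if j == 0%N then 0 else t) < (if j.+1 == 0%N then 0
  else t).
  by case: j.
have := H 1%N (fun j => if j == 0%N then 0 else t) (lexx 0) step.
rewrite big_ord1/= f0 subr0 => h; rewrite leNgt; apply/negP => At; move: h;
  apply/negP; rewrite -ltNge.
by apply: gt0_ltr_powR; rewrite ?nnegrE.
Qed.

End PvarNorm.

Section EventualBound.
Variables (R : realType) (p B : R).
Hypothesis p12 : 1 <= p < 2.
Hypothesis B_gt0 : 0 < B.
Let r_gt0 : 0 < rate p := lt_trans ltr01 (rate_gt1 p12).

(** By Bernoulli's inequality. *)
Lemma succ2_le_geometric (x : R) m : 0 < x -> m.+2%:R <= (2 + x^-1) * (1 + x)
  ^+ m.
Proof.
move=> x0; have bern : 1 + m%:R * x <= (1 + x) ^+ m.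
  elim: m => [|m IH]; first by rewrite mul0r addr0 expr0.
  have m0 : 0 <= m%:R :> R by [].
  rewrite exprS -natr1; have : 0 <= m%:R * x * x by rewrite !mulr_ge0 ?(ltW x0).
  by have := ler_wpM2l (ltW (addr_gt0 ltr01 x0)) IH; lra.
have c0 : 0 <= 2 + x^-1 by rewrite addr_ge0// invr_ge0 ltW.
apply: le_trans (ler_wpM2l c0 bern).
have -> : (2 + x^-1) * (1 + m%:R * x) = 2 + m%:R + x^-1 + 2 * (m%:R * x).
  by field; rewrite gt_eqF.
have -> : m.+2%:R = m%:R + 2 :> R by rewrite -natrD addn2.
have : 0 <= m%:R * x by rewrite mulr_ge0// ltW.
have xi : 0 < x^-1 by rewrite invr_gt0.
by move: (m%:R * x) (m%:R) => y z; lra.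
Qed.

Lemma tail_geometric : exists K : R, 0 <= K /\ forall m,
  tail_const B * m.+2%:R ^+ 3 / (rate p ^+ 4) ^+ m <= K * (rate p)^-1 ^+ m.
Proof.
have x0 : 0 < rate p - 1 by rewrite subr_gt0 rate_gt1.
pose K1 := 2 + (rate p - 1)^-1.
have K0 : 0 <= K1 by rewrite addr_ge0// invr_ge0 ltW.
have t0 := ltW (tail_const_gt0 B_gt0).
exists (tail_const B * K1 ^+ 3); split; first by rewrite mulr_ge0// exprn_ge0.
move=> m; have := @succ2_le_geometric (rate p - 1) m x0.
rewrite -/K1 subrKC => le1.
have rm0 : 0 < rate p ^+ m by rewrite exprn_gt0.
have le3 : m.+2%:R ^+ 3 <= (K1 * rate p ^+ m) ^+ 3.
  by apply: lerXn2r => //; rewrite nnegrE ?mulr_ge0 ?(ltW rm0).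
rewrite ler_pdivrMr; last by rewrite exprn_gt0// exprn_gt0.
apply: (le_trans (ler_wpM2l t0 le3)).
rewrite exprVn (exprAC _ 4) exprMn; apply: eq_ler.
by field; rewrite gt_eqF.
Qed.

Context d0 (T0 : measurableType d0) (P0 : probability T0 R) (N : \bar R -> T0
  -> R).
Hypothesis cN : counting_process N.
Hypothesis NB : {ae P0, forall w, N +oo%E w <= B}.
Context d (T : measurableType d) (P : probability T R) (Ni : nat -> \bar R -> T
  -> R).
Hypothesis cNi : forall i, counting_process (Ni i).
Hypothesis sd : forall i, same_distribution P0 N P (Ni i).
Hypothesis ind : independent_processes P Ni.

(** The bad events of the blocks have summable probabilities, so by
    Borel-Cantelli almost surely only finitely many of them occur. *)
Lemma eventually_pvar_bound : {ae P, forall w, exists m0 : nat, forall m n : nat,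
  (m0 <= m)%N -> (n <= 2 ^ m.+1)%N ->
  pvar_bound p (deviation P0 N Ni n w) (block_const p B * (2 ^ m)%:R `^ p^-1)}.
Proof.
have /choice[A AP] := block_event p12 B_gt0 cN NB cNi sd ind.
have mA m : measurable (A m) by have [] := AP m.
have [K [K0 PK]] := tail_geometric.
have fin : (\sum_(m <oo) P (A m) < +oo)%E.
  apply: (@le_lt_trans _ _ (K * (1 - (rate p)^-1)^-1)%:E); last exact: ltry.
  apply: lime_le; first exact: is_cvg_nneseries.
  apply: nearW => n; rewrite big_mkord.
  apply: (@le_trans _ _ (\sum_(k < n) (K * (rate p)^-1 ^+ k)%:E)%E).
    apply: lee_sum => k _; have [_ Pk _] := AP k; apply: le_trans Pk _.
    by rewrite lee_fin.
  by rewrite sumEFin lee_fin -mulr_sumr ler_wpM2l// geometric_sum_le.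
have lim0 := lim_sup_set_cvg0 mA fin.
have [mU PU] := unbounded_null cN NB cNi sd.
have mlim : measurable (lim_sup_set A).
  by apply: bigcap_measurable => [|k _]; [exists 0%N|exact: bigcup_measurable].
exists (unbounded_event B Ni `|` lim_sup_set A); split.
- exact: measurableU.
- apply/eqP; rewrite -measure_le0 (@le_trans _ _ (P (unbounded_event B Ni) + P
  (lim_sup_set A))%E)//.
    exact: measureU2.
  by rewrite PU lim0 adde0.
move=> w /= nw; apply: contrapT => /not_orP[nU nlim]; apply: nw.
have [m0 Hm0] : exists m0, forall m, (m0 <= m)%N -> ~ A m w.
  apply: contrapT => /forallNP H; apply: nlim => m0 _.
  by have /existsNP[m /not_implyP[m0m /contrapT Am]] := H m0; exists m.
exists m0 => m n m0m nm; have [_ _ HA] := AP m.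
exact: HA nU (Hm0 m m0m) n nm.
Qed.

Lemma eventually_pvar_norm : {ae P, forall w, exists n0 : nat, forall n : nat,
  (n0 <= n)%N ->
  (pvar_norm p (fun t => empirical_mean Ni n t%:E w - mean_function P0 N
    t%:E)%R <=
    (2 * block_const p B * n%:R `^ ((1 - p) / p))%:E)%E}.
Proof.
apply: filterS eventually_pvar_bound => w [m0 Hm0].
have p0 : 0 < p by move: p12 => /andP[]; lra.
exists (2 ^ m0)%N => n m0n.
have n0 : (0 < n)%N by rewrite (leq_trans _ m0n)// expn_gt0.
have nR : 0 < n%:R :> R by rewrite ltr0n.
have /andP[mn nm] := trunc_log_bounds (ltnSn 1) n0.
set m := trunc_log 2 n in mn nm.
have m0m : (m0 <= m)%N by rewrite trunc_log_max.
have bc0 : 0 <= block_const p B.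
  have := square_const_ge B; have := sqr_ge0 B => h1 h2.
  have sc0 : 0 <= square_const B by lra.
  have g0 : 0 <= (1 - (rate p)^-1)^-1 by rewrite invr_ge0 subr_ge0 invf_le1//
    ltW// rate_gt1.
  rewrite /block_const /chain_const; have := bottom_const_ge1 B sc0.
  have : 0 <= 9 * (1 + square_const B) / (1 - (rate p)^-1).
    by rewrite mulr_ge0// mulr_ge0// addr_ge0.
  by move=> ? ?; rewrite addr_ge0// addr_ge0// (le_trans _ (bottom_const_ge1 B
    sc0)).
have bound : pvar_bound p (deviation P0 N Ni n w) (block_const p B * n%:R `^
  p^-1).
  apply: pvar_bound_le (Hm0 m n m0m (ltnW nm)) => //.
    by rewrite mulr_ge0// powR_ge0.
  rewrite ler_wpM2l//; apply: ge0_ler_powR; rewrite ?nnegrE ?invr_ge0 ?(ltW p0)//.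
  by rewrite ler_nat.
have -> : 2 * block_const p B * n%:R `^ ((1 - p) / p) =
    2 * (n%:R^-1 * (block_const p B * n%:R `^ p^-1)).
  rewrite mulrBl mulfV ?gt_eqF// mul1r powRB; last by apply/implyP => _;
    rewrite gt_eqF.
  by rewrite powRr1 ?(ltW nR)//; ring.
apply: pvar_norm_le => //.
- by rewrite mulr_ge0 ?invr_ge0 ?mulr_ge0 ?powR_ge0 ?(ltW nR).
- rewrite /empirical_mean big1 ?mulr0 => [|i _]; last exact: counting0.
  by rewrite /mean_function unlock integral0_eq ?subr0// => x _;
    rewrite (counting0 cN).
have e t : n%:R^-1 * deviation P0 N Ni n w t =
    empirical_mean Ni n t%:E w - mean_function P0 N t%:E.
  rewrite /deviation /count_sum /empirical_mean mulrBr mulrA mulVf ?mul1r//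
    gt_eqF//.
have c0 : 0 <= n%:R^-1 :> R by rewrite invr_ge0 ltW.
have A0 : 0 <= block_const p B * n%:R `^ p^-1 by rewrite mulr_ge0 ?powR_ge0.
exact: (pvar_bound_eq (fun t _ => e t) (pvar_boundZ c0 A0 bound)).
Qed.

End EventualBound.

(** * The rate of convergence *)

Unset Implicit Arguments.

Theorem theorem4 (R : realType) (p B : R) (hp : 1 <= p < 2) (hB : 0 < B) :
  exists lambda : R,
  forall (d0 : measure_display) (T0 : measurableType d0)
    (P0 : probability T0 R) (N : \bar R -> T0 -> R)
    (d : measure_display) (T : measurableType d)
    (P : probability T R) (Ni : nat -> \bar R -> T -> R),
  counting_process N ->
  {ae P0, forall w, N +oo%E w <= B} ->
  (forall i, counting_process (Ni i)) ->
  (forall i, same_distribution P0 N P (Ni i)) ->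
  independent_processes P Ni ->
  let F := mean_function P0 N in
  let Fn := empirical_mean Ni in
  {ae P, forall w,
     (limn_esup (fun n : nat => (n%:R `^ ((p - 1) / p))%:E *
        pvar_norm p (fun t : R => (Fn n t%:E w - F t%:E)%R))
      <= lambda%:E)%E}
  /\
  {ae P, forall w, exists C : R, \forall n \near \oo,
     (pvar_norm p (fun t : R => (Fn n t%:E w - F t%:E)%R)
      <= (C * n%:R `^ ((1 - p) / p))%:E)%E}.
Proof.
exists (2 * block_const p B) => d0 T0 P0 N d T P Ni cN NB cNi sd ind /=.
have H := eventually_pvar_norm hp hB cN NB cNi sd ind.
split; apply: filterS H => w [n0 Hn0]; last first.
  by exists (2 * block_const p B); exists n0.
rewrite /limn_esup /limf_esup.
set u := (fun n : nat => _).
apply: (@le_trans _ _ (ereal_sup (u @` [set n | (n0 < n)%N]))).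
  by apply: ereal_inf_lbound; exists [set n | (n0 < n)%N] => //; exists n0.+1.
apply: ge_ereal_sup => _ [n /= n0n <-]; rewrite /u.
have nR : 0 < n%:R :> R by rewrite ltr0n (leq_ltn_trans _ n0n).
have a0 : (0 <= (n%:R `^ ((p - 1) / p))%:E)%E by rewrite lee_fin powR_ge0.
apply: (le_trans (lee_wpmul2l a0 (Hn0 n (ltnW n0n)))).
rewrite -EFinM lee_fin mulrCA -powRD; last by apply/implyP => _; rewrite gt_eqF.
have -> : (p - 1) / p + (1 - p) / p = 0 by rewrite -mulrDl -opprB addNr mul0r.
by rewrite powRr0 mulr1.
Qed.
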